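(* For every $k\ge1$: $\rho_k(t)\le\rho_{k-1}(t)$ for every $t\ge0$, with strict inequality whenever $\rho_{k-1}(t)>0$. Furthermore, $\sigma_k\ge\sigma_{k-1}+1$.
   Context: Model: vertex set $[n]$. For each unordered pair of distinct vertices, edges arrive at the points of a Poisson process of rate $1/n$ on $(0,\infty)$, independently over pairs. $G_1(t)$ is the multigraph of edges arrived by time $t$; recursively, $F_k(t)$ is the subgraph of $G_k(t)$ of those edges which at their arrival time $s\le t$ joined two different components of $G_k(s)$, and $G_{k+1}(t):=G_k(t)\setminus F_k(t)$. $C_1(G)$ is the number of vertices in the largest component of $G$. For $k\ge1$, $\rho_k:[0,\infty)\to[0,1]$ is the continuous increasing function with $C_1(G_k(t))/n\to\rho_k(t)$ in probability uniformly in $t$, and $\sigma_k>0$ is the threshold such that $\rho_k(t)=0$ for $t\le\sigma_k$ and $\rho_k(t)>0$ for $t>\sigma_k$ (existence of both is a result of the same paper). Conventions: $\rho_0(t):=1$ for all $t\ge0$ and $\sigma_0:=0$. *)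

(* Defs.v *)
From HB Require Import structures.
From mathcomp Require Import all_boot all_order all_algebra.
From mathcomp Require Import all_classical all_reals all_analysis.
From Stdlib Require Import Relations.Relation_Operators.
Set Implicit Arguments.
Unset Strict Implicit.
Unset Printing Implicit Defensive.
Import Order.TTheory GRing.Theory Num.Theory.
Import numFieldTopology.Exports numFieldNormedType.Exports.
Local Open Scope classical_set_scope.
Local Open Scope ring_scope.

Section Model.
Variable R : realType.

(* A realization on vertex set [n] = 'I_n: for each pair i < j, the set
   [arr i j] of arrival times of the edges joining i and j (values of arr on
   pairs with ~ i < j are ignored).  An edge is a triple (i, j, s) with i < j
   and s its arrival time. *)
Definition edge (n : nat) := ('I_n * 'I_n * R)%type.

Definition adj n (S : set (edge n)) (u v : 'I_n) : Prop :=
  exists s, S (u, v, s) \/ S (v, u, s).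

Definition conn n (S : set (edge n)) : 'I_n -> 'I_n -> Prop :=
  clos_refl_trans 'I_n (adj S).

Definition upto n (S : set (edge n)) (t : R) : set (edge n) :=
  [set e | S e /\ e.2 <= t].

Definition before n (S : set (edge n)) (s : R) : set (edge n) :=
  [set e | S e /\ e.2 < s].

Definition forest_part n (S : set (edge n)) : set (edge n) :=
  [set e | S e /\ ~ conn (before S e.2) e.1.1 e.1.2].

(* Gk arr k = G_{k+1} (all times), i.e. Gk arr 0 = G_1, and
   G_{k+1} = G_k \ F_k. *)
Fixpoint Gk n (arr : 'I_n -> 'I_n -> set R) (k : nat) : set (edge n) :=
  match k with
  | 0 => [set e : edge n | (e.1.1 < e.1.2)%N /\ arr e.1.1 e.1.2 e.2]
  | k'.+1 => Gk arr k' `\` forest_part (Gk arr k')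
  end.

Definition comp_size n (S : set (edge n)) (v : 'I_n) : nat :=
  #|[set u : 'I_n | `[< conn S v u >]]|.
Definition C1 n (S : set (edge n)) : nat := (\max_(v : 'I_n) comp_size S v)%N.

Definition has_card (A : set R) (m : nat) : Prop :=
  exists s : seq R, uniq s /\ size s = m /\ [set x | x \in s] = A.

(* a count constraint: (pair (i,j), interval ]a,b], number of points m) *)
Definition constr n := ('I_n * 'I_n * (R * R) * nat)%type.

Definition admissible n (cs : seq (constr n)) : Prop :=
  uniq cs /\
  (forall c, c \in cs -> (c.1.1.1 < c.1.1.2)%N /\ 0 <= c.1.2.1 < c.1.2.2) /\
  (forall c c', c \in cs -> c' \in cs -> c != c' -> c.1.1 = c'.1.1 ->
     c.1.2.2 <= c'.1.2.1 \/ c'.1.2.2 <= c.1.2.1).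

Definition count_event (T : Type) n (E : T -> 'I_n -> 'I_n -> set R)
  (cs : seq (constr n)) : set T :=
  [set w | forall c, c \in cs ->
     has_card (E w c.1.1.1 c.1.1.2 `&` `]c.1.2.1, c.1.2.2]) c.2].

(* E is a family, over the pairs i < j of [n], of independent Poisson
   processes of rate lam on (0, oo): all points are positive, and for any
   finitely many disjoint intervals (per pair), the counts are independent
   Poisson(lam * length) random variables. *)
Definition poisson_family d (T : measurableType d) (P : probability T R)
  n (lam : R) (E : T -> 'I_n -> 'I_n -> set R) : Prop :=
  (forall w (i j : 'I_n), (i < j)%N -> E w i j `<=` [set x | 0 < x]) /\
  (forall cs, admissible cs ->
     measurable (count_event E cs) /\
     P (count_event E cs) =
       (\prod_(c <- cs) poisson_pmf (lam * (c.1.2.2 - c.1.2.1)) c.2)%:E).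

Definition outer_le d (T : measurableType d) (P : probability T R)
  (A : set T) (delta : R) : Prop :=
  exists B, measurable B /\ A `<=` B /\ (P B <= delta%:E)%E.

End Model.

(* Main.v *)
Require Import Defs.
From HB Require Import structures.
From mathcomp Require Import all_boot all_order all_algebra.
From mathcomp Require Import all_classical all_reals all_analysis.
From Stdlib Require Import Relations.Relation_Operators.
From mathcomp Require Import zify ring lra fintype bigop finset.
Set Implicit Arguments.
Unset Strict Implicit.
Unset Printing Implicit Defensive.
Import Order.TTheory GRing.Theory Num.Theory.
Import numFieldTopology.Exports numFieldNormedType.Exports.
Local Open Scope ring_scope.

(* Cut time into cells so short that, with probability at least 1/2, no cell receives two
   edges.  The process is then an i.i.d. word of edges, and it suffices to contradict
   first-moment estimates for such words.

   Strict inequality: a vertex without edges up to time s which gets exactly k-1 edges during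
   (s, t], all of them to the giant component of G_k(s), belongs to the giant component
   of G_(k-1)(t) and is isolated in G_k(t).  There are linearly many such vertices.  The
   giant of G_k(s) must lie in the largest component of G_k(t), since otherwise k further
   edges would merge two macroscopic components of G_k shortly after t.

   Threshold: up to s = sigma_(k-1) all components of G_(k-1) have size o(n), so that only
   o(n) edges enter G_k.  At time t < s + 1 the graph G_k is therefore contained in the
   union of o(n) edges and a subcritical random graph on the arrivals of (s, t], whose
   susceptibility S satisfies E(n / S) >= 1 - (t - s); it has no giant component. *)

(** * Expectation over random words *)

(** Only finite count events are known to be measurable, and deviations from [rho] are controlled
    through measurable covers. Hence nothing is integrated over the sample space: words are disjoint
    count events, and expectations are finite sums [Ex] evaluated by recursion on the word.
    Discarding realizations with two edges in a cell divides by a mass of at least 1/2, which merely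
    doubles an arbitrary [delta]. The order of choices matters. Accuracy and [delta] are fixed, then
    n is taken large by convergence, and then the number r of cells per time step is taken large in
    terms of n, because a cell carries up to n tau / (2r) edges on average. The convention rho_0 = 1
    is matched by a complete graph G_0, so that the passage from rho_0 to rho_1 is an instance of
    the general step. In the subcritical part the reciprocal of S is followed: S grows on average by
    at most a multiple of S^2, so a recursion for E(S) would involve E(S^2), whereas the average
    loss of 1/S per step has a constant bound. *)

Section Expectation.
Variables (R : realFieldType) (A : finType) (w : A -> R).

(* Words are read newest letter first, so the head is drawn last. *)
Fixpoint Ex (m : nat) (f : seq A -> R) : R :=
  if m is m'.+1 then Ex m' (fun l => \sum_a w a * f (a :: l)) else f [::].

Lemma eq_Ex m f g : (forall l, size l = m -> f l = g l) -> Ex m f = Ex m g.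
Proof.
elim: m f g => [|m IH] f g fg /=; first exact: fg.
by apply: IH => l sl; apply: eq_bigr => a _; rewrite fg //= sl.
Qed.

(** Conditioning on the past: [l1] is the older part, held fixed while the newer [l2] is
    averaged. *)
Lemma Ex_cat m2 m1 f :
  Ex (m2 + m1) f = Ex m1 (fun l1 => Ex m2 (fun l2 => f (l2 ++ l1))).
Proof. by elim: m2 f => [|m2 IH] f //=; rewrite IH. Qed.

Lemma ExD m f g : Ex m (fun l => f l + g l) = Ex m f + Ex m g.
Proof.
elim: m f g => [|m IH] f g //=; rewrite -IH; apply: eq_Ex => l _.
by rewrite -big_split /=; apply: eq_bigr => a _; rewrite mulrDr.
Qed.

Lemma ExZ m c f : Ex m (fun l => c * f l) = c * Ex m f.
Proof.
elim: m f => [|m IH] f //=; rewrite -IH; apply: eq_Ex => l _.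
by rewrite mulr_sumr; apply: eq_bigr => a _; rewrite mulrCA.
Qed.

Lemma Ex_sum m (I : finType) (F : I -> seq A -> R) :
  Ex m (fun l => \sum_i F i l) = \sum_i Ex m (F i).
Proof.
elim: m F => [|m IH] F //=; rewrite -IH; apply: eq_Ex => l _.
by rewrite exchange_big /=; apply: eq_bigr => a _; rewrite mulr_sumr.
Qed.

Hypothesis w_ge0 : forall a, 0 <= w a.

Lemma le_Ex m f g : (forall l, size l = m -> f l <= g l) -> Ex m f <= Ex m g.
Proof.
elim: m f g => [|m IH] f g fg /=; first exact: fg.
apply: IH => l sl; apply: ler_sum => a _.
by apply: ler_wpM2l => //; apply: fg; rewrite /= sl.
Qed.

Hypothesis w_sum : \sum_a w a = 1.

Lemma Ex_cst m c : Ex m (fun=> c) = c.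
Proof.
elim: m => [|m IH] //=; rewrite -[RHS]IH; apply: eq_Ex => l _.
by rewrite -mulr_suml w_sum mul1r.
Qed.

Lemma Ex_drop m2 m1 f : Ex (m2 + m1) (fun l => f (drop m2 l)) = Ex m1 f.
Proof.
rewrite Ex_cat; apply: eq_Ex => l1 _; rewrite -[RHS](Ex_cst m2).
by apply: eq_Ex => l2 s2; rewrite -s2 drop_size_cat.
Qed.

End Expectation.

(** Connects the recursion with the product measure on words, the form in which the Poisson
    hypothesis delivers probabilities. *)
Lemma Ex_wordsE (R : realFieldType) (A : finType) (w : A -> R) m f :
  Ex w m f = \sum_(l : m.-tuple A) (\prod_(a <- l) w a) * f l.
Proof.
elim: m f => [|m IH] f /=.
  rewrite (big_pred1 [tuple]) ?big_nil ?mul1r // => l.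
  by apply/esym/eqP/val_inj; rewrite /= (size0nil (size_tuple l)).
rewrite IH.
transitivity (\sum_(l : m.-tuple A) \sum_a (\prod_(b <- l) w b) * (w a * f (a :: l))).
  by apply: eq_bigr => l _; rewrite mulr_sumr.
rewrite pair_bigA /=.
rewrite (reindex (fun l : m.+1.-tuple A => ([tuple of behead l], thead l))) /=.
  apply: eq_bigr => l _; rewrite [in RHS](tuple_eta l) /= big_cons.
  by rewrite mulrA [w _ * _]mulrC.
exists (fun x : m.-tuple A * A => [tuple of x.2 :: x.1]).
- by move=> l _ /=; rewrite -tuple_eta.
- by move=> [l a] _ /=; congr pair; apply/val_inj.
Qed.

(** * Components of edge lists *)

Local Open Scope nat_scope.

Section EdgeLists.
Variable V : finType.
Implicit Types (s : seq (V * V)) (u v : V).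

Definition adjs s : rel V := [rel u v | ((u, v) \in s) || ((v, u) \in s)].
Definition cns s : rel V := connect (adjs s).
Definition cls s v : {set V} := [set u | cns s v u].

Lemma cns_refl s v : cns s v v. Proof. exact: connect0. Qed.

Lemma cns_sym s u v : cns s u v = cns s v u.
Proof. by apply: sym_connect_sym => x y; rewrite /adjs /= orbC. Qed.

Lemma cns_trans s : transitive (cns s). Proof. exact: connect_trans. Qed.

Lemma cns_sub s s' u v : {subset s <= s'} -> cns s u v -> cns s' u v.
Proof.
move=> ss; apply: connect_sub => x y /= xy; apply: connect1 => /=.
by rewrite /adjs /=; case/orP: xy => /ss ->; rewrite ?orbT.
Qed.

Lemma cns_head a b s : cns ((a, b) :: s) a b.
Proof. by apply: connect1; rewrite /adjs /= mem_head. Qed.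

Lemma cns_consE a b s u v : cns ((a, b) :: s) u v ->
  [|| cns s u v, cns s u a && cns s b v | cns s u b && cns s a v].
Proof.
case/connectP => p; elim: p u => [|x p IH] u /=.
  by move=> _ ->; rewrite cns_refl.
case/andP => ux px /(IH _ px) xv.
have {ux} : [|| cns s u x, (u == a) && (x == b) | (u == b) && (x == a)].
  move: ux; rewrite /adjs /= !in_cons !xpair_eqE.
  case/orP => /orP[/andP[/eqP -> /eqP ->]|ux]; rewrite ?eqxx ?orbT //.
  + by rewrite [cns _ _ _]connect1 //= /adjs /= ux.
  + by rewrite [cns _ _ _]connect1 //= /adjs /= ux orbT.
case/or3P => [ux|/andP[/eqP ? /eqP ?]|/andP[/eqP ? /eqP ?]]; last 2 first.
- subst; rewrite !cns_refl /=; case/or3P: xv => [->|/andP[_ ->]|/andP[_ ->]];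
  by rewrite ?orbT.
- subst; rewrite !cns_refl /=; case/or3P: xv => [->|/andP[_ ->]|/andP[_ ->]];
  by rewrite ?orbT.
case/or3P: xv => [xv|/andP[xa ->]|/andP[xb ->]].
- by rewrite (cns_trans ux xv).
- by rewrite (cns_trans ux xa) orbT.
- by rewrite (cns_trans ux xb) !orbT.
Qed.

Lemma card_cls_gt0 s v : 0 < #|cls s v|.
Proof. by apply/card_gt0P; exists v; rewrite inE cns_refl. Qed.

Lemma cls_eq s u v : cns s u v -> cls s u = cls s v.
Proof.
move=> uv; apply/setP => x; rewrite !inE; apply/idP/idP; last exact: cns_trans.
by apply: cns_trans; rewrite cns_sym.
Qed.

Lemma isolated_cns s v u : (forall x, ~~ adjs s v x) -> cns s v u -> u = v.
Proof. by move=> iso /connectP[[|x p] //= /andP[vx _] _]; rewrite (negPf (iso x)) in vx. Qed.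

(** Equal to the sum of the squared component sizes; divided by the number of vertices it is the
    usual susceptibility. *)
Definition susc s : nat := \sum_v #|cls s v|.

(** Merging classes of sizes a and b raises the sum of squares by 2ab; [g] distributes this gain
    over the vertices. *)
Lemma susc_cons a b s : susc ((a, b) :: s) <= susc s + 2 * #|cls s a| * #|cls s b|.
Proof.
pose g u := (if cns s u a then #|cls s b| else 0) + (if cns s u b then #|cls s a| else 0).
have -> : 2 * #|cls s a| * #|cls s b| = \sum_u g u.
  rewrite /g big_split /= -!big_mkcond /= !sum_nat_const mulnC mulnCA mulnA.
  have E x : #|[pred u | cns s u x]| = #|cls s x|.
    by apply: eq_card => u; rewrite !inE cns_sym.
  by have := E a; have := E b; rewrite /in_mem /= => -> ->; lia.
rewrite /susc -big_split /=; apply: leq_sum => u _; rewrite /g.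
have sub : cls ((a, b) :: s) u \subset cls s u :|:
   ((if cns s u a then cls s b else set0) :|: (if cns s u b then cls s a else set0)).
  apply/subsetP => x; rewrite !inE => /cns_consE /or3P[->//|/andP[-> ?]|/andP[-> ?]].
  + by rewrite inE; apply/or3P/Or32.
  + by rewrite [x \in cls s a]inE; apply/or3P/Or33.
apply: leq_trans (subset_leq_card sub) _.
apply: leq_trans (leq_card_setU _ _) _; rewrite leq_add2l.
apply: leq_trans (leq_card_setU _ _) _.
by case: ifP => _; case: ifP => _; rewrite ?cards0.
Qed.

Definition ends s : seq V := flatten [seq [:: e.1; e.2] | e <- s].

Lemma size_ends s : size (ends s) = 2 * size s.
Proof. by elim: s => //= e s ->; lia. Qed.

(** Follow a path from [u] to [x] up to its first edge of [s]; if it has none, [z] is [x] itself. *)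
Lemma cns_cat s s' u x : cns (s ++ s') u x ->
  exists2 z, z \in x :: ends s & cns s' u z.
Proof.
elim: s x => [|[a b] s IH] x /=; first by exists x; rewrite ?mem_head.
have up z : z \in ends s -> z \in [:: x, a, b & ends s].
  by move=> zs; rewrite !in_cons zs !orbT.
move/cns_consE/or3P => h.
have [y /IH[z zs uz] yE] : exists2 y, cns (s ++ s') u y & y \in [:: x; a; b].
  case: h => [ux|/andP[ua _]|/andP[ub _]]; [exists x|exists a|exists b] => //;
  by rewrite !inE eqxx ?orbT.
exists z => //; move: zs; rewrite in_cons => /predU1P[->|/up //].
by move: yE; rewrite !inE => /or3P[]/eqP ->; rewrite eqxx ?orbT.
Qed.

Lemma leq_card_bigcup (I : finType) (P : pred I) (F : I -> {set V}) :
  #|\bigcup_(i | P i) F i| <= \sum_(i | P i) #|F i|.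
Proof.
elim/big_rec2: _ => [|i n A _ le]; first by rewrite cards0.
by apply: leq_trans (leq_card_setU _ _) _; rewrite leq_add2l.
Qed.

(** A few extra edges [s] cannot build a giant on a graph [s'] of small susceptibility. The class is
    covered by the [s']-classes of [v] and the ends of [s]: those of size at most [K] contribute at
    most K each, and by Markov at most susc / (K+1) vertices lie in larger ones. *)
Lemma card_cls_cat s s' v K : 
  #|cls (s ++ s') v| * K.+1 <= (2 * size s).+1 * K * K.+1 + susc s'.
Proof.
pose big := [set u | K < #|cls s' u|].
have cb : #|big| * K.+1 <= susc s'.
  rewrite -sum_nat_const /susc [X in _ <= X](bigID (mem big)) /=.
  by apply: leq_trans (leq_addr _ _); apply: leq_sum => u; rewrite inE.
pose r := v :: ends s.
pose U := \bigcup_(x in [set x | (x \in r) && (x \notin big)]) cls s' x.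
have sub : cls (s ++ s') v \subset U :|: big.
  apply/subsetP => u; rewrite !inE cns_sym => /cns_cat[z zr uz].
  case: (leqP #|cls s' u| K) => [uK|]; rewrite ?orbT // orbF.
  apply/bigcupP; exists z; rewrite !inE -?(cls_eq uz) -?leqNgt ?uK ?andbT //.
  by rewrite cns_sym.
have cU : #|U| <= (2 * size s).+1 * K.
  apply: leq_trans (_ : \sum_(x in [set x | (x \in r) && (x \notin big)]) K <= _); last first.
    rewrite sum_nat_const leq_mul2r; apply/orP; right.
    apply: leq_trans (_ : size r <= _); last by rewrite /= size_ends.
    apply: leq_trans (card_size r); apply: subset_leq_card.
    by apply/subsetP => x; rewrite inE => /andP[].
  apply: leq_trans (leq_card_bigcup _ _) _.
  by apply: leq_sum => x; rewrite !inE -leqNgt => /andP[].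
have := leq_trans (subset_leq_card sub) (leq_card_setU _ _).
move=> le1; apply: leq_trans (leq_mul le1 (leqnn K.+1)) _.
by rewrite mulnDl leq_add // leq_mul2r cU orbT.
Qed.

End EdgeLists.
Local Open Scope ring_scope.

(** * The forest decomposition along a word of edges *)

Local Open Scope nat_scope.

Definition pr n := {e : 'I_n * 'I_n | e.1 < e.2}.

Section Process.
Variable n : nat.
Notation letter := (option (pr n)).
Implicit Types (l : seq letter) (u v : 'I_n) (X Y : {set 'I_n}).

(* Connectivity in G_k, when [st j] lists the edges of G_(j+1); G_0 is complete. *)
Definition link (st : nat -> seq ('I_n * 'I_n)) k u v : bool :=
  if k is j.+1 then cns (st j) u v else true.

(** Being connected in G_j is the only test for entering G_(j+1): it implies connection in every
    earlier G_i, so all earlier forests have passed the edge on. [None] is an empty time cell. *)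
Fixpoint st l (j : nat) : seq ('I_n * 'I_n) :=
  match l with
  | [::] => [::]
  | None :: l' => st l' j
  | Some e :: l' =>
      if link (st l') j (val e).1 (val e).2 then val e :: st l' j else st l' j
  end.

Definition cn k l := link (st l) k.
Definition cl k l v : {set 'I_n} := [set u | cn k l v u].
Definition D1 k l : nat := \max_v #|cl k l v|.

Lemma cn_refl k l v : cn k l v v. Proof. by case: k => //= k; apply: cns_refl. Qed.

Lemma cn_sym k l u v : cn k l u v = cn k l v u.
Proof. by case: k => //= k; apply: cns_sym. Qed.

Lemma cn_trans k l : transitive (cn k l).
Proof. by case: k => // k; apply: cns_trans. Qed.

Lemma st_consS a l j : {subset st l j <= st (a :: l) j}.
Proof. by case: a => [e|] //=; case: ifP => _ x xs //; rewrite inE xs orbT. Qed.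

Lemma cn_cons a l k u v : cn k l u v -> cn k (a :: l) u v.
Proof. by case: k => // k; apply: cns_sub; apply: st_consS. Qed.

Lemma cn_cat l' l k u v : cn k l u v -> cn k (l' ++ l) u v.
Proof. by elim: l' => //= a l' IH /IH; apply: cn_cons. Qed.

Lemma st_sub l j : {subset st l j.+1 <= st l j}.
Proof.
elim: l j => [|[e|] l IH] j //= x.
case: ifP => [c|_] xs; last first.
  by case: ifP => _; rewrite ?inE (IH _ _ xs) ?orbT.
have -> : link (st l) j (val e).1 (val e).2.
  by case: j {xs} c => //= j; apply: cns_sub => y; apply: (IH j).
by move: xs; rewrite !inE => /orP[->|/IH ->]; rewrite ?orbT.
Qed.

Lemma cnS k l u v : cn k.+1 l u v -> cn k l u v.
Proof. by case: k => // k; apply: cns_sub; apply: st_sub. Qed.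

Definition touches v (a : letter) : bool :=
  if a is Some e then (v == (val e).1) || (v == (val e).2) else false.

Definition joins X Y (a : letter) : bool :=
  if a is Some e then
    ((val e).1 \in X) && ((val e).2 \in Y) || ((val e).1 \in Y) && ((val e).2 \in X)
  else false.

Lemma cn_merge X Y l l' j :
  (forall u v, u \in X -> v \in X -> cn j l u v) ->
  (forall u v, u \in Y -> v \in Y -> cn j l u v) ->
  j <= count (joins X Y) l' ->
  forall u v, u \in X -> v \in Y -> cn j (l' ++ l) u v.
Proof.
elim: l' j => [|a l' IH] j cX cY /=; first by rewrite leqn0 => /eqP ->.
case ja: (joins X Y a) => /=; last first.
  by rewrite add0n => le u v uX vY; apply: cn_cons; apply: IH.
case: j cX cY => [//|j] cX cY le u v uX vY.
case: a ja => // e ja.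
have cj : cn j (l' ++ l) (val e).1 (val e).2.
  have H := IH j (fun u v ux vx => cnS (cX u v ux vx))
                 (fun u v uy vy => cnS (cY u v uy vy)) le.
  case/orP: ja => /andP[e1 e2]; first exact: H.
  by rewrite cn_sym; apply: H.
have ce : cn j.+1 (Some e :: (l' ++ l)) (val e).1 (val e).2.
  rewrite /cn /= -/(cn j (l' ++ l) _ _) cj.
  by rewrite [X in cns (X :: _)]surjective_pairing cns_head.
case/orP: ja => /andP[e1 e2].
  apply: cn_trans (cn_cat (Some e :: l') (cX _ _ uX e1)) _.
  by apply: cn_trans ce _; apply: (cn_cat (Some e :: l')); apply: cY.
apply: cn_trans (cn_cat (Some e :: l') (cX _ _ uX e2)) _.
rewrite cn_sym; apply: cn_trans _ ce; apply: (cn_cat (Some e :: l')).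
exact: cY.
Qed.

(* Each forest F_1, ..., F_j takes one of the edges at v as long as there are any. *)
Lemma cn_isolated v l j : count (touches v) l <= j -> forall u, cn j.+1 l v u -> u = v.
Proof.
move=> le u; apply: isolated_cns => {u}; elim: l j le => [|a l IH] j /=.
  by move=> _ x; rewrite /adjs.
case: a => [e|] /=; last by rewrite add0n; apply: IH.
case te: (_ || _) => /= le x; last first.
  have {}IH := IH _ le x; case: ifP => _ //.
  case: (val e) te => b c /= /negbT; rewrite /adjs /= !inE !xpair_eqE => /norP[vb vc].
  by move: IH; rewrite /adjs /= (negPf vb) (negPf vc) /= andbF.
case: j le => [//|j] le.
have iso := IH j le.
have nl : ~~ cns (st l j) (val e).1 (val e).2.
  have ne : (val e).1 != (val e).2.
    by have := valP e; case: eqP => // ->; rewrite ltnn.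
  apply/negP => c; case/orP: te => /eqP ve.
    by move: ne; rewrite -ve in c *; rewrite (isolated_cns iso c) eqxx.
  by move: ne; rewrite cns_sym -ve in c *; rewrite (isolated_cns iso c) eqxx.
by rewrite /= (negPf nl); exact: (IH j.+1 (leqW le) x).
Qed.

Lemma card_cl_le k l v : #|cl k l v| <= D1 k l.
Proof. exact: (leq_bigmax v). Qed.

Lemma D1_cons k a l : D1 k l <= D1 k (a :: l).
Proof.
apply/bigmax_leqP => v _; apply: leq_trans (card_cl_le _ _ v).
by apply: subset_leq_card; apply/subsetP => u; rewrite !inE; apply: cn_cons.
Qed.

Lemma D1_0 l : D1 0 l = n.
Proof.
apply/eqP; rewrite eqn_leq; apply/andP; split.
  by apply/bigmax_leqP => v _; rewrite -[X in _ <= X](card_ord n) max_card.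
have [n0|n0] := posnP n; first by apply: leq_trans (_ : n <= 0) _; rewrite // n0.
apply: leq_trans (card_cl_le 0 l (Ordinal n0)).
by rewrite (_ : cl 0 l _ = setT) ?cardsT ?card_ord //; apply/setP => u; rewrite !inE.
Qed.

Lemma D1_attained k l : 0 < n -> exists v, #|cl k l v| = D1 k l.
Proof.
move=> n0; have [v vE] := @bigop.eq_bigmax 'I_n (fun v => #|cl k l v|) ltac:(by rewrite card_ord).
by exists v; rewrite /D1 vE.
Qed.

(* The j-th edge of a pendant vertex v is swallowed by the j-th forest, so that v
   joins X in G_k but is isolated in G_(k+1). *)
Definition pendant X k l1 l2 v :=
  [&& count (touches v) l1 == 0, count (touches v) l2 == k & count (joins [set v] X) l2 == k].

Lemma pendant_cn k X l1 l2 v x :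
  (forall u w, u \in X -> w \in X -> cn k l1 u w) ->
  pendant X k l1 l2 v -> x \in X -> cn k (l2 ++ l1) v x.
Proof.
move=> cX /and3P[_ _ /eqP c] xX; apply: (cn_merge (X := [set v]) _ cX); rewrite ?c ?set11 //.
by move=> u w /set1P -> /set1P ->; apply: cn_refl.
Qed.

Lemma pendant_isolated k X l1 l2 v u :
  pendant X k l1 l2 v -> cn k.+1 (l2 ++ l1) v u -> u = v.
Proof.
by move=> /and3P[/eqP c1 /eqP c2 _]; apply: cn_isolated; rewrite count_cat c1 c2 addn0.
Qed.

(** The class of [b] in G_k contains both [D] and all pendant vertices. These are disjoint, since a
    pendant vertex is alone in G_(k+1) while [D] has at least two vertices. *)
Lemma pendant_gap k X D l1 l2 b :
  (forall u w, u \in X -> w \in X -> cn k l1 u w) -> b \in X ->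
  D = cl k.+1 (l2 ++ l1) b -> 1 < #|D| ->
  #|D| + #|[set v | pendant X k l1 l2 v]| <= D1 k (l2 ++ l1).
Proof.
move=> cX bX DE D2; set Y := [set v | _].
have dj : D :&: Y = set0.
  apply/setP => v; rewrite !inE; apply/negP => /andP[vD pv].
  have iv u : u \in D -> u = v.
    move=> uD; apply: (pendant_isolated pv); apply: (@cn_trans _ _ b).
      by move: vD; rewrite DE inE cn_sym.
    by move: uD; rewrite DE inE.
  suff : #|D| <= 1 by rewrite leqNgt D2.
  rewrite -(cards1 v); apply: subset_leq_card; apply/subsetP => u /iv ->.
  exact: set11.
have := cardsUI D Y; rewrite dj cards0 addn0 => <-.
apply: leq_trans (card_cl_le _ _ b); apply: subset_leq_card; apply/subsetP => v.
rewrite !inE DE inE => /orP[/cnS //|pv]; rewrite cn_sym.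
exact: pendant_cn bX.
Qed.

(** [st y 0] keeps every edge of the window [y], hence all those that enter G_(k+1) after [l]. *)
Lemma cl_sub_window k y l v :
  cl k.+1 (y ++ l) v \subset cls (st l k ++ st y 0) v.
Proof.
apply/subsetP => u; rewrite !inE; apply: cns_sub => x {u v}.
rewrite mem_cat; elim: y => [|a y IH] /= xs; first by rewrite xs.
case: a xs => [e|] /=; last exact: IH.
case: ifP => _; rewrite ?inE => h.
  case/orP: h => [->|/IH/orP[->|->]]; rewrite ?orbT //.
by case/orP: (IH h) => ->; rewrite ?orbT.
Qed.

Lemma D1_window k y l K : 0 < n ->
  D1 k.+1 (y ++ l) * K.+1 <= (2 * size (st l k)).+1 * K * K.+1 + susc (st y 0).
Proof.
move=> n0; have [v <-] := D1_attained k.+1 (y ++ l) n0.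
apply: leq_trans (card_cls_cat (st l k) (st y 0) v K).
by rewrite leq_mul2r subset_leq_card ?cl_sub_window ?orbT.
Qed.

Lemma susc_nil : susc (st [::] 0) = n.
Proof.
rewrite /susc -[RHS](card_ord n) -sum1_card; apply: eq_bigr => v _.
apply/eqP; rewrite eqn_leq card_cls_gt0 andbT -(cards1 v).
apply: subset_leq_card; apply/subsetP => u; rewrite !inE => c.
by rewrite (@isolated_cns _ [::] v u) // => x; rewrite /adjs.
Qed.

Lemma susc_ge y : n <= susc (st y 0).
Proof.
rewrite -[X in X <= _](card_ord n) -sum1_card; apply: leq_sum => v _.
exact: card_cls_gt0.
Qed.

End Process.
Local Open Scope ring_scope.

(** * First-moment estimates *)

Section PairSums.
Variable n : nat.
Implicit Types (F : 'I_n -> 'I_n -> nat) (X Y : {set 'I_n}).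

Lemma sum_pr F :
  (\sum_(e : pr n) (F (val e).1 (val e).2 + F (val e).2 (val e).1) =
   \sum_u \sum_(w | u != w) F u w)%N.
Proof.
transitivity (\sum_(x : 'I_n * 'I_n | (x.1 < x.2)%N) (F x.1 x.2 + F x.2 x.1))%N.
  rewrite (reindex_omap val (insub : 'I_n * 'I_n -> option (pr n))) /=.
    apply: eq_bigl => e; rewrite valK eqxx andbT; exact/esym/(valP e).
  by move=> x lt_x; rewrite insubT.
rewrite big_split /=.
rewrite [X in (_ + X)%N](reindex_inj (h := fun x : 'I_n * 'I_n => (x.2, x.1))) /=; last first.
  by move=> [a b] [c e] /= [-> ->].
rewrite pair_big_dep /= [RHS](bigID (fun x : 'I_n * 'I_n => (x.1 < x.2)%N)) /=.
congr addn; apply: eq_big => x //; rewrite -(inj_eq val_inj) /=; case: ltngtP => //.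
Qed.

Lemma sum_pr_le F : (\sum_(e : pr n) (F (val e).1 (val e).2 + F (val e).2 (val e).1) <=
   \sum_u \sum_w F u w)%N.
Proof.
rewrite sum_pr; apply: leq_sum => u _; rewrite [X in (_ <= X)%N](bigID (fun w => u != w)) /=.
exact: leq_addr.
Qed.

Lemma card_pr : (2 * #|{: pr n}| <= n * n)%N.
Proof.
have := sum_pr_le (fun _ _ => 1%N); rewrite !sum_nat_const !card_ord muln1 mulnC.
by rewrite mulnC.
Qed.

Lemma card_touches v : (\sum_(e : pr n) touches v (Some e) <= n)%N.
Proof.
apply: leq_trans (_ : \sum_u \sum_(w : 'I_n) (v == u) <= n)%N.
  apply: leq_trans (sum_pr_le (fun u _ => (v == u) : nat)).
  by apply: leq_sum => e _ /=; case: (_ == _); case: (_ == _).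
rewrite (bigD1 v) //= eqxx sum_nat_const card_ord muln1 big1 ?addn0 // => u.
by rewrite eq_sym => /negPf ->; rewrite big1.
Qed.

Lemma card_joins X Y : [disjoint X & Y] ->
  (\sum_(e : pr n) joins X Y (Some e) = #|X| * #|Y|)%N.
Proof.
move=> dXY.
transitivity (\sum_u \sum_(w | u != w) ((u \in X) && (w \in Y)))%N.
  rewrite -(sum_pr (fun u w => ((u \in X) && (w \in Y)) : nat)).
  apply: eq_bigr => e _ /=.
  have h u : ~~ ((u \in X) && (u \in Y)).
    by apply/negP => /andP[uX]; rewrite (disjointFr dXY uX).
  by have := h (val e).1; have := h (val e).2; do 4 case: (_ \in _).
rewrite -sum1_card big_distrl /= [RHS]big_mkcond /=; apply: eq_bigr => u _.
case: ifP => uX /=; last by rewrite big1.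
rewrite mul1n -sum1_card [RHS]big_mkcond [LHS]big_mkcond; apply: eq_bigr => w _ /=.
case: (eqVneq u w) => [<-|_] /=; last by case: ifP.
by rewrite (disjointFr dXY uX).
Qed.

Lemma card_linked k l : 
  (\sum_(e : pr n) cn k l (val e).1 (val e).2 <= n * D1 k l)%N.
Proof.
apply: leq_trans (_ : \sum_u \sum_w cn k l u w <= _)%N.
  apply: leq_trans (sum_pr_le (fun u w => cn k l u w : nat)).
  by apply: leq_sum => e _; apply: leq_addr.
rewrite -[X in (_ <= X * _)%N]card_ord -sum_nat_const; apply: leq_sum => u _.
apply: leq_trans (card_cl_le k l u).
by rewrite -sum1_card [X in (_ <= X)%N]big_mkcond /=; apply: leq_sum => w _; rewrite inE; case: cn.
Qed.

End PairSums.

Section Estimates.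
Variables (R : realFieldType) (n : nat) (p : R).
Notation letter := (option (pr n)).
Implicit Types (l : seq letter) (X Y : {set 'I_n}) (v : 'I_n).

Definition wt (a : letter) : R := if a is Some _ then p else 1 - #|{: pr n}|%:R * p.
Notation EX := (Ex wt).

Lemma sum_letter (f : letter -> R) : \sum_a f a = f None + \sum_e f (Some e).
Proof.
rewrite (bigD1 None) //=; congr (_ + _); rewrite (reindex_omap Some id) /=; last by case.
by apply: eq_bigl => e; rewrite eqxx.
Qed.

Lemma sum_wt : \sum_a wt a = 1.
Proof. by rewrite sum_letter /= sumr_const -[p *+ _]mulr_natl subrK. Qed.

Lemma sum_wt_nat (f : letter -> nat) : f None = 0%N ->
  \sum_a wt a * (f a)%:R = p * (\sum_e f (Some e))%N%:R.
Proof.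
by move=> f0; rewrite sum_letter /= f0 mulr0 add0r natr_sum mulr_sumr.
Qed.

Hypothesis p_ge0 : 0 <= p.
Hypothesis p_le : #|{: pr n}|%:R * p <= 1.

Lemma wt_ge0 a : 0 <= wt a.
Proof. by case: a => //=; rewrite subr_ge0. Qed.

Definition hits X v j l : bool :=
  (count (touches v) l == j) && (count (joins [set v] X) l == j).

Lemma joins_touches X v a : joins [set v] X a -> touches v a.
Proof.
case: a => //= e /orP[]/andP[]; rewrite !inE => H1 H2.
  by rewrite (eqP H1) eqxx.
by rewrite (eqP H2) eqxx orbT.
Qed.

(** A binomial lower bound, by Pascal's rule applied to the newest letter, which either joins [v] to
    [X] or avoids [v]. Using the exponent [m] in place of m - j only weakens the bound and keeps
    subtraction out of the induction. *)
Lemma Ex_hits X v j m : v \notin X -> p * n%:R <= 1 ->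
  'C(m, j)%:R * (p * #|X|%:R) ^+ j * (1 - p * n%:R) ^+ m <= EX m (fun l => (hits X v j l)%:R).
Proof.
move=> vX pn.
have q0 : 0 <= 1 - p * n%:R by rewrite subr_ge0.
have x0 : 0 <= p * #|X|%:R by rewrite mulr_ge0.
have sT : 1 - p * n%:R <= \sum_a wt a * (~~ touches v a)%:R.
  have -> : \sum_a wt a * (~~ touches v a)%:R = 1 - \sum_a wt a * (touches v a)%:R.
    rewrite -[X in X - _]sum_wt -sumrB; apply: eq_bigr => a _.
    by case: touches; rewrite /= ?mulr1 ?mulr0 ?subr0 ?subrr.
  rewrite lerD2l lerN2 (sum_wt_nat (f := fun a => touches v a)) //.
  by rewrite ler_wpM2l // ler_nat card_touches.
have sJ : \sum_a wt a * (joins [set v] X a)%:R = p * #|X|%:R.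
  rewrite (sum_wt_nat (f := fun a => joins [set v] X a)) // card_joins ?cards1 ?mul1n //.
  by rewrite disjoints1.
elim: m j => [|m IH] [|j] /=.
- by rewrite !expr0 bin0 !mulr1.
- by rewrite bin0n mul0r mul0r.
- rewrite bin0 expr0 !mul1r.
  apply: (@le_trans _ _ (EX m (fun l => (1 - p * n%:R) * (hits X v 0 l)%:R))).
    rewrite ExZ exprS ler_wpM2l //; apply: le_trans (IH 0%N).
    by rewrite bin0 expr0 !mul1r.
  apply: (le_Ex wt_ge0) => l _.
  apply: le_trans (ler_wpM2r (ler0n _ _) sT) _.
  rewrite mulr_suml; apply: ler_sum => a _; rewrite -mulrA ler_wpM2l ?wt_ge0 //.
  rewrite -natrM mulnb ler_nat /hits /=.
  case ta : (touches v a); case ja : (joins [set v] X a); rewrite //=.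
  by rewrite (joins_touches ja) in ta.
- apply: (@le_trans _ _ (EX m (fun l => (p * #|X|%:R) * (hits X v j l)%:R +
       (1 - p * n%:R) * (hits X v j.+1 l)%:R))).
    rewrite ExD !ExZ.
    apply: le_trans (lerD (ler_wpM2l x0 (IH j)) (ler_wpM2l q0 (IH j.+1))).
    rewrite binS natrD.
    set A := 'C(m, j)%:R; set B := 'C(m, j.+1)%:R.
    set x := p * #|X|%:R in x0 *; set q := 1 - p * n%:R in q0 *.
    have -> : x * (A * x ^+ j * q ^+ m) + q * (B * x ^+ j.+1 * q ^+ m) =
      (B + A) * x ^+ j.+1 * q ^+ m.+1 + (1 - q) * (A * x ^+ j.+1 * q ^+ m).
      by rewrite !exprS; ring.
    rewrite lerDl mulr_ge0 //; last by rewrite !mulr_ge0 ?exprn_ge0 ?ler0n.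
    by rewrite subr_ge0 /q lerBlDr lerDl mulr_ge0.
  apply: (le_Ex wt_ge0) => l _; rewrite -sJ.
  apply: le_trans (lerD (lexx _) (ler_wpM2r (ler0n _ _) sT)) _.
  rewrite !mulr_suml -big_split; apply: ler_sum => a _ /=.
  rewrite -!mulrA -mulrDr ler_wpM2l ?wt_ge0 //.
  rewrite -!natrM -natrD !mulnb ler_nat /hits /=.
  case ta : (touches v a); case ja : (joins [set v] X a); rewrite //= ?add1n ?eqSS ?addn0 //.
  by rewrite (joins_touches ja) in ta.
Qed.

(* Markov's inequality for 2^-(number of joining letters). *)
Lemma Ex_few_joins X Y k m : [disjoint X & Y] ->
  EX m (fun l => (count (joins X Y) l < k)%:R) <=
  2 ^+ k * (1 - p * (#|X| * #|Y|)%:R / 2) ^+ m.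
Proof.
move=> dXY; pose g l : R := 2^-1 ^+ count (joins X Y) l.
have Eg : EX m g = (1 - p * (#|X| * #|Y|)%:R / 2) ^+ m.
  elim: m => [|m IH] //=; rewrite exprS -IH -ExZ; apply: eq_Ex => l _.
  have <- : \sum_a wt a * (2^-1 ^+ joins X Y a) = 1 - p * (#|X| * #|Y|)%:R / 2.
    rewrite -card_joins // -(sum_wt_nat (f := fun a => joins X Y a)) // -[X in X - _]sum_wt.
    rewrite mulr_suml -sumrB; apply: eq_bigr => a _.
    by case: joins; rewrite /= ?expr1 ?expr0 ?mulr1 ?mulr0 ?mul0r ?subr0 //; field.
  rewrite mulr_suml; apply: eq_bigr => a _.
  by rewrite /g /= exprD mulrA.
rewrite -Eg -ExZ; apply: (le_Ex wt_ge0) => l _.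
case: ltnP => h; last by rewrite mulr_ge0 ?exprn_ge0 ?invr_ge0.
rewrite /g exprVn -(subnK (ltnW h)) exprD mulfK ?expf_neq0 ?pnatr_eq0 //.
by rewrite exprn_ege1 // ler1n.
Qed.

(** An edge enters G_(k+1) only inside a component of G_k, and there are at most n K such pairs
    while these have size at most [K]. As [D1] only grows, the indicator at the end controls all
    earlier steps. *)
Lemma Ex_size_st k m K :
  EX m (fun l => (size (st l k))%:R * (D1 k l <= K)%N%:R) <= p * (m * n * K)%:R.
Proof.
elim: m => [|m IH] /=; first by rewrite mul0r !mul0n mulr0.
apply: (@le_trans _ _ (EX m (fun l => (size (st l k))%:R * (D1 k l <= K)%N%:R + p * (n * K)%:R))).
  apply: (le_Ex wt_ge0) => l _.
  case: (leqP (D1 k l) K) => DK; last first.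
    rewrite big1 ?mulr0 ?add0r ?mulr_ge0 // => a _.
    by rewrite leqNgt (leq_trans DK (D1_cons _ _ _)) /= !mulr0.
  apply: (@le_trans _ _ (\sum_a wt a * ((size (st l k))%:R +
     (if a is Some e then cn k l (val e).1 (val e).2 else false)%:R))).
    apply: ler_sum => a _; rewrite ler_wpM2l ?wt_ge0 // -natrM -natrD ler_nat.
    apply: leq_trans (leq_mul (leqnn _) (leq_b1 _)) _; rewrite muln1.
    case: a => [e|] /=; last by rewrite addn0.
    by rewrite /cn; case: link; rewrite ?addn1 ?addn0.
  under eq_bigr do rewrite mulrDr.
  rewrite big_split /= -mulr_suml sum_wt mul1r mulr1 lerD2l.
  rewrite (sum_wt_nat (f := fun a => if a is Some e then cn k l (val e).1 (val e).2 else false)) //.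
  rewrite ler_wpM2l // ler_nat; apply: leq_trans (card_linked k l) _.
  by rewrite leq_mul2l DK orbT.
rewrite ExD (Ex_cst sum_wt).
by rewrite -mulnA mulSn natrD mulrDr addrC lerD2l mulnA.
Qed.

(* A new edge between classes of sizes a and b raises susc by at most 2ab; summed over
   all edges this is at most susc^2, so 1/susc loses at most p on average at each step. *)
Lemma Ex_susc m : (0 < n)%N ->
  1 - n%:R * p * m%:R <= EX m (fun y => n%:R / (susc (st y 0))%:R).
Proof.
move=> n0; rewrite ExZ.
suff h : n%:R^-1 - p * m%:R <= EX m (fun y => (susc (st y 0))%:R^-1).
  apply: le_trans (ler_wpM2l (ler0n _ _) h).
  by rewrite mulrBr divff ?mulrA // pnatr_eq0 -lt0n.
elim: m => [|m IH]; first by rewrite /= susc_nil mulr0 subr0.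
rewrite /=.
apply: (@le_trans _ _ (EX m (fun y => (susc (st y 0))%:R^-1 + - p))).
  by rewrite ExD (Ex_cst sum_wt) -natr1 mulrDr mulr1 opprD addrA lerD2r.
apply: (le_Ex wt_ge0) => y _.
set S := susc (st y 0).
have S0 : 0 < S%:R :> R by rewrite ltr0n; apply: leq_trans n0 (susc_ge y).
pose d (a : letter) := (if a is Some e then
  2 * #|cls (st y 0) (val e).1| * #|cls (st y 0) (val e).2| else 0)%N.
have dS : \sum_a wt a * (d a)%:R <= p * S%:R ^+ 2.
  rewrite sum_wt_nat // ler_wpM2l // -natrX ler_nat.
  pose F u w := (#|cls (st y 0) u| * #|cls (st y 0) w|)%N.
  apply: leq_trans (_ : \sum_(u : 'I_n) \sum_(w : 'I_n) F u w <= _)%N.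
    apply: leq_trans (sum_pr_le F); apply: leq_sum => e _.
    by rewrite /d /F -mulnA mulSn mul1n [X in (_ <= _ + X)%N]mulnC.
  rewrite /F -mulnn /S /susc big_distrl /=; apply: leq_sum => u _.
  by rewrite big_distrr.
apply: (@le_trans _ _ (\sum_a wt a * (S%:R^-1 - (d a)%:R / S%:R ^+ 2))); last first.
  apply: ler_sum => a _; rewrite ler_wpM2l ?wt_ge0 //.
  have S' : (susc (st (a :: y) 0) <= S + d a)%N.
    by case: a => [e|] /=; rewrite ?addn0 // [X in X :: _]surjective_pairing susc_cons.
  have S'0 : 0 < (susc (st (a :: y) 0))%:R :> R.
    by rewrite ltr0n; apply: leq_trans n0 (susc_ge _).
  apply: (@le_trans _ _ (S + d a)%:R^-1); last by rewrite lef_pV2 ?posrE ?ler_nat ?natrD ?ltr_wpDr.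
  rewrite natrD; have : 0 <= (d a)%:R :> R by []; move: (d a)%:R => x x0.
  have sx : 0 < S%:R + x by rewrite ltr_wpDr.
  rewrite -[leRHS]mul1r ler_pdivlMr //.
  have -> : (S%:R^-1 - x / S%:R ^+ 2) * (S%:R + x) = 1 - (x / S%:R) ^+ 2.
    by field; rewrite gt_eqF.
  by rewrite lerBlDr lerDl sqr_ge0.
under eq_bigr do rewrite mulrBr mulrA.
rewrite sumrB -!mulr_suml sum_wt mul1r lerD2l lerN2.
by rewrite ler_pdivrMr ?exprn_gt0.
Qed.

End Estimates.

(** * From Poisson processes to words *)

Section Transfer.
Local Open Scope classical_set_scope.
Variables (R : realType) (n : nat).

Lemma conn_cns (S : set (edge R n)) (s : seq ('I_n * 'I_n)) :
  (forall u v, (exists t, S (u, v, t)) <-> (u, v) \in s) ->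
  forall u v, conn S u v <-> cns s u v.
Proof.
move=> Ss u v; split.
  elim=> [x y [t [St|St]]|x|x y z _ xy _ yz].
  - by apply: connect1; rewrite /adjs /=; apply/orP; left; apply/Ss; exists t.
  - by apply: connect1; rewrite /adjs /=; apply/orP; right; apply/Ss; exists t.
  - exact: cns_refl.
  - exact: cns_trans xy yz.
case/connectP => p; elim: p u => [|x p IH] u /=.
  by move=> _ ->; apply: rt_refl.
case/andP => ux px /(IH _ px) xv; apply: rt_trans xv; apply: rt_step.
by case/orP: ux => /Ss[t St]; exists t; [left|right].
Qed.

Lemma has_card0 (A : set R) : has_card A 0 -> forall x, ~ A x.
Proof. by case=> s [_ [/size0nil -> <-]] x. Qed.

Lemma has_card1 (A : set R) : has_card A 1 -> exists x, forall y, A y <-> y = x.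
Proof.
case=> [[|x [|y s]]] [_ [//= _ <-]]; exists x => y /=.
by rewrite inE; split => /eqP.
Qed.

Lemma Gk_arr (arr : 'I_n -> 'I_n -> set R) k u v s :
  Gk arr k (u, v, s) -> (u < v)%N /\ arr u v s.
Proof. by elim: k => [//|k IH] [/IH]. Qed.

Lemma GkS (arr : 'I_n -> 'I_n -> set R) k e :
  Gk arr k.+1 e <-> Gk arr k e /\ conn (before (Gk arr k) e.2) e.1.1 e.1.2.
Proof.
split=> [[Ge nF]|[Ge ce]]; split=> //.
  by apply: contrapT => nc; apply: nF.
by case.
Qed.

Variables (h : R) (h_gt0 : 0 < h).

(** The letter above [l'] governs the cell of length [h] starting at (size l') h. Every pair is
    constrained, so a realized cell holds one edge or none. *)
Fixpoint cells (l : seq (option (pr n))) : seq (constr R n) :=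
  if l is a :: l' then
    [seq (val e, ((size l')%:R * h, (size l').+1%:R * h), (a == Some e) : nat)
      | e <- enum {: pr n}] ++ cells l'
  else [::].

Variable arr : 'I_n -> 'I_n -> set R.
Hypothesis arr_gt0 : forall i j : 'I_n, (i < j)%N -> arr i j `<=` [set x | 0 < x].

Definition realizes l := forall c, c \in cells l ->
  has_card (arr c.1.1.1 c.1.1.2 `&` `]c.1.2.1, c.1.2.2]) c.2.

Lemma realizes_cat l' l : realizes (l' ++ l) -> realizes l.
Proof.
elim: l' => //= a l' IH H; apply: IH => c cl; apply: H => /=.
by rewrite mem_cat cl orbT.
Qed.

Lemma realizes_head a l (u v : 'I_n) s : realizes (a :: l) -> (u < v)%N ->
  arr u v s -> s <= (size l).+1%:R * h -> (size l)%:R * h < s -> omap val a = Some (u, v).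
Proof.
move=> H uv av s1 s0; pose e : pr n := exist _ (u, v) uv.
have /H /= : (val e, ((size l)%:R * h, (size l).+1%:R * h), (a == Some e) : nat) \in cells (a :: l).
  by rewrite /= mem_cat; apply/orP; left; apply/mapP; exists e; rewrite ?mem_enum.
case: eqP => [-> //|_] /has_card0 /(_ s) []; split=> //=.
by rewrite in_itv /= s0.
Qed.

Lemma realizes_point e l : realizes (Some e :: l) ->
  exists x, [/\ (size l)%:R * h < x, x <= (size l).+1%:R * h, arr (val e).1 (val e).2 x &
   forall s, arr (val e).1 (val e).2 s -> s <= (size l).+1%:R * h -> (size l)%:R * h < s -> s = x].
Proof.
move=> H.
have /H /= : (val e, ((size l)%:R * h, (size l).+1%:R * h), (Some e == Some e) : nat) \in cells (Some e :: l).
  by rewrite /= mem_cat; apply/orP; left; apply/mapP; exists e; rewrite ?mem_enum.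
rewrite eqxx => /has_card1[x xE]; have [ax] := (xE x).2 erefl.
rewrite /= in_itv /= => /andP[x0 x1]; exists x; split=> // s as_ s1 s0.
by apply/xE; split=> //=; rewrite in_itv /= s0.
Qed.

(** With at most one arrival per cell, the word determines the order of all arrivals, and the
    forests depend on nothing else. *)
Lemma realizes_st l : realizes l -> forall k u v,
  (exists s, s <= (size l)%:R * h /\ Gk arr k (u, v, s)) <-> (u, v) \in st l k.
Proof.
elim: l => [|a l IH] H k u v.
  split=> // -[s [+ /Gk_arr[uv /(arr_gt0 uv)]]] /=.
  by rewrite mul0r => s0 /(le_lt_trans s0); rewrite ltxx.
have {}IH := IH (@realizes_cat [:: a] l H).
have mono : (size l)%:R * h <= (size l).+1%:R * h by rewrite ler_pM2r // ler_nat.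
case: a H => [e|] H /=; last first.
  rewrite -IH; split=> -[s [s1 Gs]]; exists s; split=> //; last exact: le_trans s1 mono.
  have [uv av] := Gk_arr Gs; rewrite leNgt; apply/negP => s0.
  by have := realizes_head H uv av s1 s0.
have [x [x0 x1 ax xu]] := realizes_point H.
have early j v1 v2 s : Gk arr j (v1, v2, s) -> s <= (size l).+1%:R * h ->
    s <= (size l)%:R * h \/ ((v1, v2) = val e /\ s = x).
  move=> Gs s1; case: (leP s ((size l)%:R * h)) => s0; [by left|right].
  have [uv av] := Gk_arr Gs.
  have := realizes_head H uv av s1 s0 => /= -[ve]; split=> //.
  by apply: xu => //; rewrite [\val e]ve.
(* Nothing else happens in this cell, so the graph strictly before [x] is the one at the end of the
   previous cell. *)
have cb j v1 v2 : conn (before (Gk arr j) x) v1 v2 <-> cn j.+1 l v1 v2.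
  apply: conn_cns => {}u {}v; rewrite -IH; split=> -[s].
    case=> Gs /= sx; exists s; split=> //.
    have [//|[_ sE]] := early _ _ _ _ Gs (ltW (lt_le_trans sx x1)).
    by rewrite sE ltxx in sx.
  by case=> s0 Gs; exists s; split=> //=; apply: le_lt_trans x0.
have Ge j : Gk arr j ((val e).1, (val e).2, x) <-> cn j l (val e).1 (val e).2.
  elim: j => [|j IHj].
    by split=> // _; split=> //=; apply: (valP e).
  rewrite GkS /= cb; split=> [[//]|c]; split=> //; apply/IHj; exact: cnS.
rewrite -/(cn k l _ _).
have -> : ((u, v) \in (if cn k l (val e).1 (val e).2 then val e :: st l k else st l k)) =
   (cn k l (val e).1 (val e).2 && ((u, v) == val e)) || ((u, v) \in st l k).
  by case: ifP.
split.
  case=> s [s1 Gs]; have [s0|[ve sx]] := early _ _ _ _ Gs s1.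
    by apply/orP; right; apply/IH; exists s.
  apply/orP; left; rewrite ve eqxx andbT; apply/Ge; rewrite -sx.
  by move: Gs ve => /[swap] <-.
case/orP => [/andP[/Ge Gx /eqP ve]|/IH[s [s0 Gs]]].
  by exists x; split=> //; move: Gx; rewrite -ve.
by exists s; split=> //; apply: le_trans mono.
Qed.

Lemma realizes_C1 l k : realizes l -> C1 (upto (Gk arr k) ((size l)%:R * h)) = D1 k.+1 l.
Proof.
move=> H; apply: eq_bigr => v _; apply: eq_card => u; rewrite !inE.
have cE : conn (upto (Gk arr k) ((size l)%:R * h)) v u <-> cn k.+1 l v u.
  apply: conn_cns => {}u {}v; rewrite -realizes_st //.
  by split=> -[s [Gs s0]]; exists s; split.
by apply/asboolP/idP => [/asboolP/cE|/cE ?] //; apply/asboolP.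
Qed.

End Transfer.

(** * Probability that a given word is realized *)

Section WordProbability.
Local Open Scope classical_set_scope.
Variable R : realType.

Lemma sum_measure_le (d : measure_display) (T : measurableType d) (P : probability T R)
  (I : eqType) (r : seq I) (F : I -> set T) (B : set T) :
  uniq r -> measurable B -> (forall i, i \in r -> measurable (F i)) ->
  (forall i j w, i \in r -> j \in r -> F i w -> F j w -> i = j) ->
  (forall i, i \in r -> F i `<=` B) -> (\sum_(i <- r) P (F i) <= P B)%E.
Proof.
elim: r B => [|i r IH] B /=; first by rewrite big_nil.
case/andP => ir ur mB mF dF FB; rewrite big_cons.
have mFi : measurable (F i) by apply: mF; rewrite mem_head.
have FiB : F i `<=` B by apply: FB; rewrite mem_head.
have sub : {subset r <= i :: r} by move=> j jr; rewrite inE jr orbT.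
have {IH}IH : (\sum_(j <- r) P (F j) <= P (B `\` F i))%E.
  apply: IH => //; first exact: measurableD.
  - by move=> j jr; apply: mF; apply: sub.
  - by move=> j k w jr kr; apply: dF; apply: sub.
  - move=> j jr w Fjw; split; first exact: (FB j (sub _ jr)).
    move=> Fiw; have ij := dF _ _ _ (mem_head i r) (sub _ jr) Fiw Fjw.
    by rewrite ij jr in ir.
have -> : P B = (P (F i) + P (B `\` F i))%E.
  rewrite -measureU //; last 2 first.
  - exact: measurableD.
  - by apply/seteqP; split=> w // [Fw []].
  by congr (P _); apply/seteqP; split=> w; [move=> Bw; have [|] := pselect (F i w); [left|right]
   | case=> [/FiB|[]]].
by apply: leeD2l.
Qed.

Lemma has_card_uniq (A : set R) a b : has_card A a -> has_card A b -> a = b.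
Proof.
case=> s [us [<- sA]] [s' [us' [<- s'A]]].
apply/perm_size/uniq_perm => // x.
apply/idP/idP => xs.
  by have : A x; [rewrite -sA | rewrite -s'A].
by have : A x; [rewrite -s'A | rewrite -sA].
Qed.

Variables (n : nat) (h : R).
Hypothesis h_gt0 : 0 < h.
Notation letter := (option (pr n)).

(** Here [s] counts cells from time 0, whereas words start with the newest letter; hence [rev]. *)
Definition cell (l : seq letter) (s : nat) (e : pr n) : constr R n :=
  (val e, (s%:R * h, s.+1%:R * h), (nth None (rev l) s == Some e) : nat).

Lemma cellsP (l : seq letter) c : c \in cells h l -> exists s e, (s < size l)%N /\ c = cell l s e.
Proof.
elim: l => //= a l IH; rewrite mem_cat => /orP[/mapP[e _ ->]|/IH[s [e [sl ->]]]].
  exists (size l), e; split=> //; congr (_, _); rewrite rev_cons nth_rcons size_rev ltnn eqxx //.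
exists s, e; split; first exact: ltnW.
by rewrite /cell rev_cons nth_rcons size_rev sl.
Qed.

Lemma mulh_inj (s s' : nat) : s%:R * h = s'%:R * h -> s = s'.
Proof. by move/(mulIf (lt0r_neq0 h_gt0))/eqP; rewrite eqr_nat => /eqP. Qed.

Lemma admissible_cells (l : seq letter) : admissible (cells h l).
Proof.
split; last split.
- elim: l => //= a l IH; rewrite cat_uniq IH andbT map_inj_uniq ?enum_uniq /=; last first.
    by move=> e e' [/val_inj].
  apply/hasPn => c /cellsP[s [e [sl ->]]]; apply/negP => /mapP[e' _ [_ /mulh_inj ss _]].
  by rewrite ss ltnn in sl.
- move=> c /cellsP[s [e [sl ->]]] /=.
  have -> : 0 <= s%:R * h by rewrite mulr_ge0 ?ler0n // ltW.
  split; first exact: (valP e).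
  by rewrite /= ltr_pM2r // ltr_nat ltnSn.
move=> c c' /cellsP[s [e [sl ->]]] /cellsP[s' [e' [sl' ->]]] /= ne /val_inj ee.
have : s != s' by apply: contra ne => /eqP ->; rewrite ee.
by rewrite neq_ltn => /orP[ss|ss]; [left|right]; rewrite ler_pM2r // ler_nat.
Qed.

(** Makes the events of distinct words of one length disjoint, so that their probabilities add
    up. *)
Lemma realizes_inj (arr : 'I_n -> 'I_n -> set R) (l l' : seq letter) :
  size l = size l' -> realizes h arr l -> realizes h arr l' -> l = l'.
Proof.
elim: l l' => [|a l IH] [|a' l'] //= [sl] H H'.
rewrite (IH l' sl (@realizes_cat _ _ _ _ [:: a] l H) (@realizes_cat _ _ _ _ [:: a'] l' H')); congr cons.
have E e : (a == Some e) = (a' == Some e).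
  have /H /= h1 : (val e, ((size l)%:R * h, (size l).+1%:R * h), (a == Some e) : nat) \in cells h (a :: l).
    by rewrite /= mem_cat; apply/orP; left; apply/mapP; exists e; rewrite ?mem_enum.
  have /H' /= h2 : (val e, ((size l')%:R * h, (size l').+1%:R * h), (a' == Some e) : nat) \in cells h (a' :: l').
    by rewrite /= mem_cat; apply/orP; left; apply/mapP; exists e; rewrite ?mem_enum.
  rewrite sl in h1; have := has_card_uniq h1 h2.
  by case: (a == _); case: (a' == _).
case: a a' E {H H'} => [e|] [e'|] E //.
- by have := E e; rewrite eqxx => /esym/eqP.
- by have := E e; rewrite eqxx.
- by have := E e'; rewrite eqxx.
Qed.

Variable lam : R.
Hypothesis lam_gt0 : 0 < lam.
Notation N := #|{: pr n}|.

(* Probability that a cell contains a given edge, conditionally on its containing at most one. *)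
Definition one_edge_prob := lam * h / (1 + N%:R * (lam * h)).
(* Probability that a cell contains at most one edge. *)
Definition cell_mass := (1 + N%:R * (lam * h)) * expR (- (lam * h)) ^+ N.

Lemma one_edge_prob_ge0 : 0 <= one_edge_prob.
Proof.
have lh : 0 <= lam * h by rewrite mulr_ge0 // ltW.
by rewrite divr_ge0 // addr_ge0 // mulr_ge0.
Qed.

Lemma den_gt0 : 0 < 1 + N%:R * (lam * h).
Proof. by rewrite ltr_wpDr // mulr_ge0 // mulr_ge0 // ltW. Qed.

Lemma one_edge_prob_le : N%:R * one_edge_prob <= 1.
Proof. by rewrite mulrA ler_pdivrMr ?den_gt0 // mul1r lerDr. Qed.

(** In one cell the Poisson weights multiply to exp(-lam h)^N, times lam h if an edge is present.
    Normalized by their total [cell_mass] they become [wt], so the letters are i.i.d. given at most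
    one edge per cell. *)
Lemma prod_pmf (l : seq letter) : \prod_(c <- cells h l) poisson_pmf (lam * (c.1.2.2 - c.1.2.1)) c.2 =
  cell_mass ^+ size l * \prod_(a <- l) wt one_edge_prob a.
Proof.
elim: l => [|a l IH] /=; first by rewrite !big_nil mulr1.
rewrite big_cat big_map IH big_cons /= exprS.
rewrite [RHS]mulrACA; congr (_ * _).
have lh : 0 < lam * h by rewrite mulr_gt0.
transitivity (\prod_(e : pr n) (expR (- (lam * h)) * (if a == Some e then lam * h else 1))).
  rewrite big_enum /=; apply: eq_bigr => e _.
  have -> : lam * ((size l).+1%:R * h - (size l)%:R * h) = lam * h.
    by rewrite -mulrBl -natr1 addrC addKr mul1r.
  rewrite /poisson_pmf lh; case: eqP => _ /=.
    by rewrite expr1 (_ : 1`! = 1%N) // invr1 mulr1 mulrC.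
  by rewrite expr0 fact0 invr1 !mulr1 mul1r.
rewrite big_split /= prodr_const /cell_mass mulrAC mulrC; congr (_ * _).
have D0 := lt0r_neq0 den_gt0.
case: a => [e|] /=.
  rewrite (bigD1 e) //= eqxx big1 ?mulr1; last first.
    by move=> e' /negPf ee; rewrite (inj_eq (@Some_inj _)) eq_sym ee.
  by rewrite /one_edge_prob; field.
by rewrite big1 // /one_edge_prob; field.
Qed.

(** The passage from the sample space to words: the events of the words in [W] are measurable,
    disjoint and contained in the cover [B] of [A]. *)
Lemma Ex_bad (d : measure_display) (T : measurableType d) (P : probability T R)
   (E : T -> 'I_n -> 'I_n -> set R) (A : set T) delta m (W : seq letter -> bool) :
  poisson_family P lam E -> outer_le P A delta ->
  (forall l w, size l = m -> W l -> realizes h (E w) l -> A w) ->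
  cell_mass ^+ m * Ex (wt one_edge_prob) m (fun l => (W l)%:R) <= delta.
Proof.
move=> [_ poi] [B [mB [AB PB]]] WA.
have pl (l : m.-tuple letter) := poi _ (admissible_cells l).
have := @sum_measure_le _ _ P _ [seq l <- enum {: m.-tuple letter} | W (tval l)]
  (fun l : m.-tuple letter => count_event E (cells h l)) B (filter_uniq _ (enum_uniq _)) mB.
move=> /(_ (fun l _ => (pl l).1)) H.
have {}H : (\sum_(l <- enum {: m.-tuple letter} | W (tval l)) P (count_event E (cells h (tval l))) <= P B)%E.
  rewrite -big_filter; apply: H.
    by move=> l l' w _ _ H H'; apply/val_inj/(realizes_inj _ H H'); rewrite !size_tuple.
  by move=> l + w H; rewrite mem_filter => /andP[Wl _]; apply/AB/(WA l w _ Wl H); rewrite size_tuple.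
rewrite -lee_fin; apply: le_trans PB; apply: le_trans H; rewrite big_enum_cond /=.
rewrite (eq_bigr (fun l : m.-tuple letter =>
  (cell_mass ^+ m * (\prod_(a <- l) wt one_edge_prob a))%:E)); last first.
  by move=> l _; rewrite (pl l).2 prod_pmf size_tuple.
rewrite sumEFin lee_fin Ex_wordsE -mulr_sumr.
rewrite [X in _ <= _ * X]big_mkcond /=.
apply: ler_wpM2l; first by rewrite exprn_ge0 // mulr_ge0 ?(ltW den_gt0) // exprn_ge0 // expR_ge0.
by apply: ler_sum => l _; case: (W l); rewrite ?mulr1 ?mulr0.
Qed.

(** Combines (1+a) exp(-a) >= (1+a)(1-a) = 1 - a^2 with Bernoulli's inequality. *)
Lemma cell_mass_ge m : N%:R * (lam * h) <= 1 ->
  m%:R * (N%:R * (lam * h)) ^+ 2 <= 2^-1 -> 2^-1 <= cell_mass ^+ m.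
Proof.
set a := N%:R * (lam * h) => a1 ma.
have a0 : 0 <= a by rewrite !mulr_ge0 // ltW.
have ca : 1 - a ^+ 2 <= cell_mass.
  rewrite /cell_mass -/a -expRM_natl.
  have -> : 1 - a ^+ 2 = (1 + a) * (1 + - a) by ring.
  rewrite ler_wpM2l ?addr_ge0 //.
  by rewrite mulrN -/a expR_ge1Dx.
have q0 : 0 <= 1 - a ^+ 2 by rewrite subr_ge0 expr_le1.
have : (1 - a ^+ 2) ^+ m <= cell_mass ^+ m.
  by apply: lerXn2r (ca); rewrite nnegrE // (le_trans q0 ca).
apply: le_trans.
apply: (@le_trans _ _ (1 - m%:R * a ^+ 2)); first by lra.
elim: m {ma} => [|m IH]; first by rewrite mul0r subr0 expr0.
rewrite [X in _ <= X]exprS; apply: le_trans (ler_wpM2l q0 IH).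
rewrite -natr1; have : 0 <= m%:R * (a ^+ 2) ^+ 2 by rewrite mulr_ge0 ?sqr_ge0.
move: (a ^+ 2) => x; move: (m%:R) => y; nra.
Qed.

End WordProbability.

(** * Asymptotics on a fine grid *)

Section Grid.
Variable R : realType.

(* The unit of time tau is divided into r cells; edges arrive at rate 1/n. *)
Definition pp n (tau : R) r : R := one_edge_prob n (tau / r%:R) (n%:R^-1).

Variables (n r : nat) (tau : R).
Hypotheses (n_gt0 : (0 < n)%N) (r_gt0 : (0 < r)%N) (tau_gt0 : 0 < tau).

Let h_gt0 : 0 < tau / r%:R. Proof. by rewrite divr_gt0 // ltr0n. Qed.
Let lam_gt0 : 0 < n%:R^-1 :> R. Proof. by rewrite invr_gt0 ltr0n. Qed.

Lemma pp_ge0 : 0 <= pp n tau r. Proof. exact: one_edge_prob_ge0. Qed.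

Lemma pp_card : #|{: pr n}|%:R * pp n tau r <= 1. Proof. exact: one_edge_prob_le. Qed.

Lemma pp_le : pp n tau r * n%:R <= tau / r%:R.
Proof.
have n0 : 0 < n%:R :> R by rewrite ltr0n.
rewrite -ler_pdivlMr // /pp /one_edge_prob ler_pdivrMr ?den_gt0 //.
have x0 : 0 <= n%:R^-1 * (tau / r%:R) by rewrite mulr_ge0 // ltW.
rewrite [tau / _ / _]mulrC; move: (n%:R^-1 * _) x0 => x x0.
by rewrite ler_peMr // lerDl mulr_ge0.
Qed.

Lemma cell_mean_le : #|{: pr n}|%:R * (n%:R^-1 * (tau / r%:R)) <= n%:R * tau / r%:R / 2.
Proof.
have n0 : 0 < n%:R :> R by rewrite ltr0n.
have N2 : 2 * #|{: pr n}|%:R <= n%:R * n%:R :> R by rewrite -!natrM ler_nat card_pr.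
have -> : n%:R * tau / r%:R / 2 = (n%:R * n%:R / 2) * (n%:R^-1 * (tau / r%:R)).
  by field; rewrite !gt_eqF // ltr0n.
apply: ler_wpM2r; first by rewrite mulr_ge0 // ltW.
by rewrite ler_pdivlMr // mulrC.
Qed.

Lemma pp_ge : n%:R * tau <= r%:R -> tau / r%:R / 2 <= pp n tau r * n%:R.
Proof.
move=> nr; have n0 : 0 < n%:R :> R by rewrite ltr0n.
have r0 : 0 < r%:R :> R by rewrite ltr0n.
have a1 : #|{: pr n}|%:R * (n%:R^-1 * (tau / r%:R)) <= 1.
  apply: le_trans cell_mean_le _; rewrite ler_pdivrMr // mul1r ler_pdivrMr //; lra.
rewrite /pp /one_edge_prob [leRHS]mulrAC ler_pdivlMr ?den_gt0 //.
have -> : n%:R^-1 * (tau / r%:R) * n%:R = tau / r%:R by field; rewrite !gt_eqF.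
have aux (a x : R) : 0 < x -> a <= 1 -> x / 2 * (1 + a) <= x by nra.
exact: aux.
Qed.

(** Each of the J r cells has mean at most n tau / (2r), so the total defect is at most J (n tau)^2
    / (4r). *)
Lemma grid_mass J : n%:R * tau <= r%:R -> J%:R * (n%:R * tau) ^+ 2 <= r%:R ->
  2^-1 <= cell_mass n (tau / r%:R) (n%:R^-1) ^+ (J * r).
Proof.
move=> nr Jr; have r0 : 0 < r%:R :> R by rewrite ltr0n.
have x1 : n%:R * tau / r%:R <= 1 by rewrite ler_pdivrMr // mul1r.
have a0 : 0 <= #|{: pr n}|%:R * (n%:R^-1 * (tau / r%:R)).
  by rewrite mulr_ge0 // mulr_ge0 // ltW.
have aX := cell_mean_le.
apply: cell_mass_ge => //; first lra.
apply: (@le_trans _ _ ((J * r)%:R * (n%:R * tau / r%:R / 2) ^+ 2)).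
  by rewrite ler_wpM2l // lerXn2r ?nnegrE ?(le_trans a0 aX).
have -> : (J * r)%:R * (n%:R * tau / r%:R / 2) ^+ 2 = J%:R * (n%:R * tau) ^+ 2 / r%:R / 4.
  by rewrite natrM; field; rewrite gt_eqF.
have : J%:R * (n%:R * tau) ^+ 2 / r%:R <= 1 by rewrite ler_pdivrMr // mul1r.
lra.
Qed.

Lemma pow_ge_exp m : tau / r%:R <= 2^-1 ->
  expR (- (2 * (tau / r%:R) * m%:R)) <= (1 - pp n tau r * n%:R) ^+ m.
Proof.
set x := tau / r%:R => x2.
have x0 : 0 < x := h_gt0.
apply: (@le_trans _ _ ((1 - x) ^+ m)); last first.
  by apply: lerXn2r; rewrite ?nnegrE; have := pp_le; rewrite -/x; lra.
rewrite mulrC -mulrN expRM_natl; apply: lerXn2r; rewrite ?nnegrE ?expR_ge0 //; first lra.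
have e1 : 1 + 2 * x <= expR (2 * x) by apply: expR_ge1Dx.
have e0 := expR_gt0 (2 * x).
rewrite expRN -div1r ler_pdivrMr //.
apply: le_trans (ler_wpM2l _ e1); last lra.
have : 0 <= x * (1 - 2 * x) by apply: mulr_ge0; lra.
lra.
Qed.

End Grid.

(** * Pendant vertices and the gap between consecutive largest components *)

Section Gap.
Variable n : nat.
Notation letter := (option (pr n)).
Implicit Types (l : seq letter).

Definition giant k l : {set 'I_n} :=
  if [pick v | #|cl k l v| == D1 k l] is Some v then cl k l v else set0.

Lemma giantP k l : (0 < n)%N -> exists v, giant k l = cl k l v /\ #|cl k l v| = D1 k l.
Proof.
move=> n0; rewrite /giant; case: pickP => [v /eqP vE|no]; first by exists v.
by have [v vE] := D1_attained k l n0; have := no v; rewrite vE eqxx.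
Qed.

(** Either the old giant lies in the new one and [pendant_gap] applies, or the two are disjoint;
    then k+1 joining edges in [l3] merge them, unless fewer arrive. *)
Lemma strict_gap k l1 l2 l3 : (0 < n)%N -> (1 < #|giant k.+1 (l2 ++ l1)|)%N ->
  [\/ (D1 k.+1 (l2 ++ l1) + #|[set v | pendant (giant k.+1 l1) k l1 l2 v]| <= D1 k (l2 ++ l1))%N,
      (D1 k.+1 (l2 ++ l1) + D1 k.+1 l1 <= D1 k.+1 (l3 ++ l2 ++ l1))%N |
      [disjoint giant k.+1 (l2 ++ l1) & giant k.+1 l1] /\
      (count (joins (giant k.+1 (l2 ++ l1)) (giant k.+1 l1)) l3 < k.+1)%N].
Proof.
move=> n0.
have [b [BE Bc]] := giantP k.+1 l1 n0; have [c [DE Dc]] := giantP k.+1 (l2 ++ l1) n0.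
rewrite BE DE -Bc -Dc => D2.
have bB : b \in cl k.+1 l1 b by rewrite inE cn_refl.
have cB u w : u \in cl k.+1 l1 b -> w \in cl k.+1 l1 b -> cn k.+1 l1 u w.
  by rewrite !inE => bu bw; apply: cn_trans bw; rewrite cn_sym.
have cD u w : u \in cl k.+1 (l2 ++ l1) c -> w \in cl k.+1 (l2 ++ l1) c -> cn k.+1 (l2 ++ l1) u w.
  by rewrite !inE => cu cw; apply: cn_trans cw; rewrite cn_sym.
have [bD|bD] := boolP (b \in cl k.+1 (l2 ++ l1) c).
  apply: Or31; apply: (pendant_gap _ bB _ D2); first by move=> u w uB wB; apply/cnS/cB.
  by apply/setP => u; rewrite !inE in bD *; apply/idP/idP; apply: cn_trans; rewrite // cn_sym.
have dj : [disjoint cl k.+1 (l2 ++ l1) c & cl k.+1 l1 b].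
  apply/pred0P => u /=; apply/negbTE; apply: contra bD => /andP[]; rewrite !inE => cu bu.
  by apply: cn_trans cu _; rewrite cn_sym; apply: cn_cat.
have [lt|ge] := ltnP (count (joins (cl k.+1 (l2 ++ l1) c) (cl k.+1 l1 b)) l3) k.+1.
  exact: Or33.
apply: Or32; have -> : (#|cl k.+1 (l2 ++ l1) c| + #|cl k.+1 l1 b| =
   #|cl k.+1 (l2 ++ l1) c :|: cl k.+1 l1 b|)%N.
  by rewrite -cardsUI (disjoint_setI0 dj) cards0 addn0.
apply: leq_trans (card_cl_le _ _ c); apply: subset_leq_card; apply/subsetP => u.
rewrite !inE => /orP[cu|bu]; first exact: cn_cat.
have cB' u' w : u' \in cl k.+1 l1 b -> w \in cl k.+1 l1 b -> cn k.+1 (l2 ++ l1) u' w.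
  by move=> *; apply: cn_cat; apply: cB.
by apply: (cn_merge cD cB' ge); rewrite inE ?cn_refl.
Qed.

Variables (R : realFieldType) (p : R).
Hypothesis p_ge0 : 0 <= p.
Hypothesis p_le : #|{: pr n}|%:R * p <= 1.
Hypothesis pn_le : p * n%:R <= 1.
Notation EX := (Ex (wt p)).

Lemma Ex_untouched v m : (1 - p * n%:R) ^+ m <= EX m (fun l => (count (touches v) l == 0%N)%:R).
Proof.
have := @Ex_hits R n p p_ge0 p_le set0 v 0 m; rewrite inE => /(_ isT pn_le).
rewrite bin0 expr0 !mul1r => /le_trans; apply; apply: le_Ex => [a|l _]; first exact: wt_ge0.
by rewrite ler_nat /hits; case: (_ == _) => //=; case: (_ == _).
Qed.

(** On average at least n c0 vertices are untouched by [l1], and at most n del are lost to words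
    whose giant is smaller than [b]. Given [l1], [Ex_hits] makes each remaining one pendant with
    probability at least [c1]. *)
Lemma Ex_pendant k m1 m2 (b c0 c1 del : R) : (0 < n)%N -> 1 < b -> 0 <= c1 ->
  c0 <= (1 - p * n%:R) ^+ m1 ->
  c1 <= 'C(m2, k)%:R * (p * b) ^+ k * (1 - p * n%:R) ^+ m2 ->
  EX m1 (fun l => ((D1 k.+1 l)%:R < b)%R%:R) <= del ->
  n%:R * ((c0 - del) * c1) <= EX m1 (fun l1 => EX m2 (fun l2 =>
     (b <= (D1 k.+1 l1)%:R)%R%:R * #|[set v | pendant (giant k.+1 l1) k l1 l2 v]|%:R)).
Proof.
move=> n0 b1 c10 c0P c1P dP; have wt0 := wt_ge0 p_ge0 p_le.
pose U l := \sum_(v : 'I_n) (count (touches v) l == 0%N)%:R : R.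
have UP : n%:R * c0 <= EX m1 U.
  rewrite /U Ex_sum -{1}(card_ord n) mulr_natl -sumr_const; apply: ler_sum => v _.
  exact: le_trans (Ex_untouched v m1).
apply: (@le_trans _ _ (EX m1 (fun l => c1 * (U l + - n%:R * ((D1 k.+1 l)%:R < b)%R%:R)))).
  rewrite ExZ ExD ExZ mulrA [_ * c1]mulrC ler_wpM2l // mulrBr mulNr lerD // lerN2.
  by rewrite ler_wpM2l.
apply: le_Ex => // l1 _.
case: (ltP (D1 k.+1 l1)%:R b) => Db /=.
  rewrite (@eq_Ex _ _ _ _ _ (fun=> 0)); last by move=> *; rewrite mul0r.
  rewrite Ex_cst ?sum_wt // mulr_ge0_le0 // mulr1 subr_le0.
  apply: (@le_trans _ _ (\sum_(v : 'I_n) (1 : R))); last by rewrite sumr_const card_ord.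
  by apply: ler_sum => v _; case: (_ == _).
rewrite mulr0 addr0 ExZ mul1r.
apply: (@le_trans _ _ (\sum_(v : 'I_n) EX m2 (fun l2 => (pendant (giant k.+1 l1) k l1 l2 v)%:R))); last first.
  rewrite -Ex_sum; apply: le_Ex => // l2 _; rewrite -natr_sum ler_nat.
  rewrite -sum1_card [X in (_ <= X)%N]big_mkcond /=; apply: leq_sum => v _.
  by rewrite inE; case: pendant.
rewrite /U mulr_sumr; apply: ler_sum => v _.
case ut : (count (touches v) l1 == 0%N); last first.
  rewrite mulr0 -[X in X <= _](Ex_cst (sum_wt n p) m2); exact: le_Ex.
rewrite mulr1 (@eq_Ex _ _ _ _ _ (fun l2 => (hits (giant k.+1 l1) v k l2)%:R)); last first.
  by move=> l2 _; rewrite /pendant ut.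
have [w [GE Gc]] := giantP k.+1 l1 n0.
(* An untouched vertex is isolated in G_(k+1), whereas the giant has at least b > 1 vertices. *)
have vG : v \notin giant k.+1 l1.
  apply/negP; rewrite GE inE => wv.
  have iso u : cn k.+1 l1 v u -> u = v by apply: cn_isolated; rewrite (eqP ut).
  suff : (#|cl k.+1 l1 w| <= 1)%N by rewrite -(ler_nat R) Gc; apply/negP; rewrite -ltNge; apply: lt_le_trans Db.
  rewrite -(cards1 v); apply: subset_leq_card; apply/subsetP => u; rewrite !inE => wu.
  by apply/eqP/iso; apply: cn_trans wu; rewrite cn_sym.
apply: le_trans c1P _; apply: le_trans (Ex_hits p_ge0 p_le k m2 vG pn_le).
have q0 : 0 <= 1 - p * n%:R by rewrite subr_ge0.
rewrite ler_wpM2r ?exprn_ge0 // ler_wpM2l // lerXn2r ?nnegrE ?mulr_ge0 //.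
- by apply: ltW; apply: lt_trans b1.
- by rewrite ler_wpM2l // GE Gc.
Qed.

End Gap.

(** * Binomial and exponential bounds, and the arithmetic of the error terms *)

Lemma ffact_ge r k : ((r - k) ^ k <= r ^_ k)%N.
Proof.
elim: k r => [|k IH] [|r] //; first by rewrite exp0n.
rewrite ffactSS subSS expnS leq_mul //.
by apply: leq_trans (leq_subr _ _) _.
Qed.

Lemma bin_ge (R : realFieldType) r k : (2 * k <= r)%N ->
  (r%:R / 2) ^+ k / k`!%:R <= 'C(r, k)%:R :> R.
Proof.
move=> kr; rewrite ler_pdivrMr ?ltr0n ?fact_gt0 // -natrM bin_ffact.
apply: (@le_trans _ _ ((r - k) ^ k)%N%:R); last by rewrite ler_nat ffact_ge.
rewrite natrX; apply: lerXn2r; rewrite ?nnegrE ?ler0n ?divr_ge0 //.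
rewrite ler_pdivrMr // -natrM ler_nat; lia.
Qed.

Lemma Ex_merge_fail (R : realType) n r (tau : R) k (X Y : {set 'I_n}) : (0 < n)%N -> (0 < r)%N -> 0 < tau ->
  n%:R * tau <= r%:R -> [disjoint X & Y] ->
  Ex (wt (pp n tau r)) r (fun l => (count (joins X Y) l < k)%:R) <=
  2 ^+ k * expR (- ((#|X| * #|Y|)%:R / n%:R * tau / 4)).
Proof.
move=> n0 r0 tau0 nr dXY.
have nR : 0 < n%:R :> R by rewrite ltr0n.
have rR : 0 < r%:R :> R by rewrite ltr0n.
have p0 : 0 <= pp n tau r by apply: pp_ge0.
have pN : #|{: pr n}|%:R * pp n tau r <= 1 by apply: pp_card.
apply: le_trans (Ex_few_joins p0 pN k r dXY) _.
rewrite ler_wpM2l ?exprn_ge0 //.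
set s := (#|X| * #|Y|)%:R : R.
have s0 : 0 <= s by [].
have sN : pp n tau r * s <= 1.
  apply: le_trans pN; rewrite mulrC ler_wpM2r // ler_nat -card_joins // -sum1_card.
  by apply: leq_sum => e _; apply: leq_b1.
have ps : tau / r%:R / 2 / n%:R * s <= pp n tau r * s.
  by rewrite ler_wpM2r // ler_pdivrMr //; apply: pp_ge.
apply: (@le_trans _ _ (expR (- (tau / r%:R / 2 / n%:R * s / 2)) ^+ r)).
  apply: lerXn2r; rewrite ?nnegrE ?expR_ge0 //; first lra.
  apply: le_trans (expR_ge1Dx _); lra.
rewrite -expRM_natl ler_expR le_eqVlt; apply/orP; left; apply/eqP.
by field; rewrite !gt_eqF.
Qed.

Lemma min_pos (R : realType) (x y : R) : 0 < x -> 0 < y -> exists e, [/\ 0 < e, e <= x & e <= y].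
Proof.
move=> x0 y0; exists (Num.min x y); split; first by rewrite lt_min x0.
  by rewrite ge_min lexx.
by rewrite ge_min lexx orbT.
Qed.

(** The crude bound exp(-x) <= 1/x suffices; 32 is the product of the 4 in the exponent and the 8 in
    the target. *)
Lemma merge_fail_small (R : realType) (n : nat) (tau be c s : R) k :
  0 < n%:R :> R -> 0 < tau -> 0 < be -> 0 < c ->
  2 ^+ k * 32 / (c * be ^+ 2 * tau) <= n%:R ->
  be ^+ 2 * (n%:R * n%:R) <= s ->
  2 ^+ k * expR (- (s / n%:R * tau / 4)) <= c / 8.
Proof.
move=> n0 tau0 be0 c0 An sn.
have bt0 : 0 < be ^+ 2 * tau by rewrite mulr_gt0 // exprn_gt0.
apply: (@le_trans _ _ (2 ^+ k * expR (- (be ^+ 2 * n%:R * tau / 4)))).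
  rewrite ler_pM2l ?exprn_gt0 // ler_expR lerN2 !ler_pM2r ?invr_gt0 //.
  by rewrite ler_pdivlMr // -mulrA.
set x := be ^+ 2 * n%:R * tau / 4.
have x0 : 0 < x by rewrite /x mulrAC !mulr_gt0 ?invr_gt0.
have ex : x <= expR x by apply: le_trans (expR_ge1Dx x); rewrite lerDr.
rewrite expRN ler_pdivrMr ?expR_gt0 //; apply: le_trans (ler_wpM2l _ ex); last first.
  by rewrite ltW // divr_gt0.
move: An; rewrite ler_pdivrMr; last by rewrite -mulrA mulr_gt0.
rewrite /x; lra.
Qed.

Lemma gap_arith (R : realType) (x y e n D D' Y : R) : y <= x ->
  (x - e) * n <= D -> D' <= (y + e) * n -> D + Y <= D' -> 0 <= n -> Y <= n * (2 * e).
Proof.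
move=> yx h1 h2 h3 n0; have : y * n <= x * n by rewrite ler_wpM2r.
lra.
Qed.

(** Here x, y, z are limit densities at three successive grid times. Merging would force z >= x + y
    - 3e >= y + 5b/8, beyond the permitted y + b/2. *)
Lemma merge_arith (R : realType) (x y z b e n Ds Dt DT : R) : 0 < n -> 0 < b -> e <= b / 8 ->
  b <= x -> z <= y + b / 2 ->
  (x - e) * n <= Ds -> (y - e) * n <= Dt -> DT <= (z + e) * n -> Dt + Ds <= DT -> False.
Proof.
move=> n0 b0 eb bx zy h1 h2 h3 h4.
have : (x - e + (y - e)) * n <= (z + e) * n by lra.
rewrite ler_pM2r //; lra.
Qed.

Lemma final_arith (R : realType) (c e de : R) : 0 < c -> e <= c / 8 -> de <= c / 32 ->
  c <= 2 * e + (2 * de + 2 * de) + c / 8 -> False.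
Proof. lra. Qed.

(** * The limit functions *)

Section Limits.
Local Open Scope classical_set_scope.
Variables (R : realType) (d : nat -> measure_display) (Omega : forall n, measurableType (d n)).
Variables (P : forall n, probability (Omega n) R).
Variables (E : forall n, Omega n -> 'I_n -> 'I_n -> set R) (rho : nat -> R -> R).
Hypothesis poi : forall n, (0 < n)%N -> poisson_family (P n) (n%:R)^-1 (@E n).
Hypothesis rho0 : forall t, 0 <= t -> rho 0%N t = 1.
Hypothesis conv : forall k, (1 <= k)%N -> forall eps delta : R, 0 < eps -> 0 < delta ->
     \forall n \near \oo,
       outer_le (P n)
         [set w | exists t, 0 <= t /\
            eps < `| (C1 (upto (Gk (@E n w) k.-1) t))%:R / n%:R - rho k t |]
         delta.

(** Words start with the newest letter, so dropping (J - i) r letters leaves the state at time i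
    tau. *)
Definition dev n k r J (tau eps : R) (l : seq (option (pr n))) : bool :=
  [exists i : 'I_J.+1,
    eps < `|(D1 k (drop ((J - i) * r) l))%:R / n%:R - rho k (i%:R * tau)|].

Lemma devPn n k r J (tau eps : R) (l' l : seq (option (pr n))) i :
  ~~ dev k r J tau eps (l' ++ l) -> (i <= J)%N -> size l' = ((J - i) * r)%N ->
  `|(D1 k l)%:R / n%:R - rho k (i%:R * tau)| <= eps.
Proof.
move=> + iJ sl'; rewrite negb_exists => /forallP/(_ (Ordinal (iJ : (i < J.+1)%N))) /=.
by rewrite -leNgt -sl' drop_size_cat.
Qed.

(** A deviating word forces a deviation of the process, at the cost of a factor 1 / mass <= 2. The
    bound [r0] grows with [n] to meet the conditions of [grid_mass]. *)
Lemma rare k J (tau eps delta : R) : 0 < tau -> 0 < eps -> 0 < delta ->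
  exists N, forall n, (N <= n)%N -> (0 < n)%N -> exists r0, forall r, (r0 <= r)%N ->
    Ex (wt (pp n tau r)) (J * r) (fun l : seq (option (pr n)) => (dev k r J tau eps l)%:R) <= 2 * delta.
Proof.
move=> tau0 eps0 delta0.
have [->|k0] := posnP k.
  exists 0%N => n _ n0; exists 1%N => r r0.
  apply: (@le_trans _ _ 0); last by rewrite mulr_ge0 // ltW.
  rewrite le_eqVlt; apply/orP; left; rewrite -[X in _ == X](Ex_cst (sum_wt n (pp n tau r)) (J * r) 0).
  apply/eqP/eq_Ex.
  move=> l _; rewrite (_ : dev _ _ _ _ _ _ = false) //; apply/negbTE.
  rewrite negb_exists; apply/forallP => i.
  rewrite D1_0 divff ?pnatr_eq0 -?lt0n // rho0 ?mulr_ge0 ?(ltW tau0) //.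
  by rewrite subrr normr0 -leNgt ltW.
have [N _ HN] := conv k0 eps0 delta0.
exists N => n Nn n0; have {HN}An := HN n Nn.
exists (Num.truncn (1 + n%:R * tau + J%:R * (n%:R * tau) ^+ 2)).+1 => r rX.
have nt0 : 0 <= n%:R * tau by rewrite mulr_ge0 // ltW.
have Jt0 : 0 <= J%:R * (n%:R * tau) ^+ 2 by rewrite mulr_ge0 // sqr_ge0.
have X0 : 0 <= 1 + n%:R * tau + J%:R * (n%:R * tau) ^+ 2 by lra.
have {}rX : 1 + n%:R * tau + J%:R * (n%:R * tau) ^+ 2 <= r%:R.
  have := truncnS_gt (1 + n%:R * tau + J%:R * (n%:R * tau) ^+ 2).
  by move/ltW/le_trans; apply; rewrite ler_nat.
have r0 : (0 < r)%N by rewrite -(ltr0n R); lra.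
have h0 : 0 < tau / r%:R by rewrite divr_gt0 // ltr0n.
have lam0 : 0 < n%:R^-1 :> R by rewrite invr_gt0 ltr0n.
have mass : 2^-1 <= cell_mass n (tau / r%:R) (n%:R^-1) ^+ (J * r).
  by apply: grid_mass => //; lra.
have := Ex_bad h0 lam0 (m := (J * r)%N) (W := @dev n k r J tau eps) (poi n0) An.
set X := Ex _ _ _ => H; have {H} : cell_mass n (tau / r%:R) n%:R^-1 ^+ (J * r) * X <= delta.
  apply: H => l w sl /existsP[i di] rl.
  exists (i%:R * tau); split; first by rewrite mulr_ge0 // ltW.
  move: di; rewrite -{1}(prednK k0).
  set l1 := drop _ _; have sl1 : size l1 = (i * r)%N.
    rewrite size_drop sl -mulnBl; congr muln; apply: subKn; exact: (ltn_ord i).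
  rewrite -(realizes_C1 h0 ((poi n0).1 w)).
    rewrite sl1 natrM -mulrA (_ : r%:R * (tau / r%:R) = tau) ?prednK //.
    by field; rewrite gt_eqF // ltr0n.
  by apply: (@realizes_cat _ _ _ _ (take ((J - i) * r) l)); rewrite cat_take_drop.
rewrite -/(pp n tau r) in X *.
have X00 : 0 <= X.
  rewrite -(Ex_cst (sum_wt n (pp n tau r)) (J * r) 0).
  by apply: le_Ex => [a|l _]; rewrite ?wt_ge0 ?pp_ge0 ?pp_card ?ler0n.
move: (cell_mass _ _ _ ^+ _) mass => c c2 cX.
have : 2^-1 * X <= delta by apply: le_trans cX; rewrite ler_wpM2r.
lra.
Qed.

Lemma common_nr (k1 k2 J : nat) (tau e1 e2 d1 d2 : R) (N0 : nat) :
  0 < tau -> 0 < e1 -> 0 < e2 -> 0 < d1 -> 0 < d2 ->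
  exists n, [/\ (N0 <= n)%N, (0 < n)%N & forall r0 : nat, exists r, [/\ (r0 <= r)%N, (0 < r)%N,
    Ex (wt (pp n tau r)) (J * r) (fun l : seq (option (pr n)) => (dev k1 r J tau e1 l)%:R) <= 2 * d1 &
    Ex (wt (pp n tau r)) (J * r) (fun l : seq (option (pr n)) => (dev k2 r J tau e2 l)%:R) <= 2 * d2]].
Proof.
move=> t0 e10 e20 d10 d20.
have [N1 H1] := rare k1 J t0 e10 d10; have [N2 H2] := rare k2 J t0 e20 d20.
pose n := (maxn N0 (maxn N1 N2)).+1.
exists n; split=> [||r0]; [by rewrite /n; lia|by []|].
have n1 : (N1 <= n)%N by rewrite /n; lia.
have n2 : (N2 <= n)%N by rewrite /n; lia.
have [r1 {}H1] := H1 n n1 isT; have [r2 {}H2] := H2 n n2 isT.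
exists (maxn r0 (maxn r1 r2)).+1; split=> //; first lia.
  by apply: H1; lia.
by apply: H2; lia.
Qed.

Lemma le_EX n (tau : R) r m f g : (0 < n)%N -> (0 < r)%N -> 0 < tau ->
  (forall l : seq (option (pr n)), size l = m -> f l <= g l) ->
  Ex (wt (pp n tau r)) m f <= Ex (wt (pp n tau r)) m g.
Proof. by move=> n0 r0 t0; apply: le_Ex => a; rewrite wt_ge0 ?pp_ge0 ?pp_card. Qed.

(** Every word satisfies D1 k.+1 <= D1 k. Were the limits in the wrong order, each word would
    deviate at one of the two levels, while such words have total weight at most 1/4 + 1/4. *)
Lemma rho_mono k t : 0 < t -> rho k.+1 t <= rho k t.
Proof.
move=> t0; rewrite leNgt; apply/negP => lt.
set e := (rho k.+1 t - rho k t) / 4.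
have e0 : 0 < e by rewrite divr_gt0 ?subr_gt0.
have q0 : 0 < 8^-1 :> R by rewrite invr_gt0.
have [n [_ n0 /(_ 0%N)[r [_ r0 H1 H2]]]] := common_nr k.+1 k 1 0 t0 e0 e0 q0 q0.
have : 1 <= Ex (wt (pp n t r)) (1 * r) (fun l : seq (option (pr n)) =>
    (dev k.+1 r 1 t e l)%:R + (dev k r 1 t e l)%:R).
  rewrite -[X in X <= _](Ex_cst (sum_wt n (pp n t r)) (1 * r)); apply: le_EX => // l _.
  case V1: (dev k.+1 _ _ _ _ _); first by rewrite /= mulr1n lerDl ler0n.
  case V2: (dev k _ _ _ _ _); first by rewrite /= mulr1n lerDr ler0n.
  have := devPn (l' := [::]) (negbT V1) (leqnn _); rewrite subnn mul1r => /(_ erefl).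
  have := devPn (l' := [::]) (negbT V2) (leqnn _); rewrite subnn mul1r => /(_ erefl).
  rewrite !ler_norml => /andP[_ a2] /andP[b1 _].
  have : (D1 k.+1 l)%:R / n%:R <= (D1 k l)%:R / n%:R :> R.
    rewrite ler_wpM2r ?invr_ge0 // ler_nat; apply/bigmax_leqP => v _.
    apply: leq_trans (card_cl_le k l v).
    by apply: subset_leq_card; apply/subsetP => u; rewrite !inE; apply: cnS.
  rewrite /e in a2 b1; lra.
rewrite ExD; lra.
Qed.

(* Up to time i * tau few edges enter G_(k+1), and the edges arriving later form a
   subcritical graph, because j * tau < 1. *)
Lemma no_giant k i j (tau : R) : 0 < tau -> j%:R * tau < 1 ->
  i = 0%N \/ rho k (i%:R * tau) = 0 -> rho k.+1 ((i + j)%:R * tau) <= 0.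
Proof.
move=> tau0 jt sub; rewrite leNgt; apply/negP.
set x := rho _ _ => x0.
set g := 1 - j%:R * tau; have g0 : 0 < g by rewrite subr_gt0.
(* The constants balance [D1_window]: with fewer than z n old edges, S < 2n/g and n >= 4q/x, its
   right side splits into three parts of at most x n q / 4 each, while a giant makes the left side
   at least 3 x n q / 4. *)
pose K0 := Num.truncn (8 / (g * x)); pose q : R := K0.+1%:R.
have q0 : 0 < q by rewrite ltr0n.
have qE : 8 <= q * (g * x).
  by rewrite -ler_pdivrMr ?mulr_gt0 // ltW // truncnS_gt.
pose z := x / (8 * q).
have z0 : 0 < z by rewrite divr_gt0 // mulr_gt0.
pose a := 1 + i%:R * tau; have a0 : 0 < a by rewrite ltr_pwDl // mulr_ge0 // ltW.
(* Components of G_k of size at most e n admit on average at most i tau e n edges up to time i tau;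
   this choice makes that at most z n g / 8. *)
pose e := z * g / (8 * a).
have e0 : 0 < e by rewrite divr_gt0 // mulr_gt0.
have x40 : 0 < x / 4 by rewrite divr_gt0.
have d0 : 0 < g / 32 by rewrite divr_gt0.
pose N0 := (Num.truncn (4 * q / x)).+1.
have [n [Nn n0 /(_ 0%N)[r [_ r0 H1 H2]]]] := common_nr k.+1 k (i + j) N0 tau0 x40 e0 d0 d0.
have nR : 0 < n%:R :> R by rewrite ltr0n.
have qn : 4 * q <= n%:R * x.
  rewrite -ler_pdivrMr // ltW //; apply: lt_le_trans (truncnS_gt _) _.
  by rewrite ler_nat.
have zn0 : 0 < z * n%:R by rewrite mulr_gt0.
pose K := Num.truncn (e * n%:R).
pose Z (l : seq (option (pr n))) : R := (size (st l k))%:R * (D1 k l <= K)%N%:R.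
have key (l1 y : seq (option (pr n))) : size l1 = (i * r)%N -> size y = (j * r)%N ->
  n%:R / (susc (st y 0))%:R <= g / 2 +
    ((dev k.+1 r (i + j) tau (x / 4) (y ++ l1))%:R + (dev k r (i + j) tau e (y ++ l1))%:R)
    + (z * n%:R)^-1 * Z l1.
  move=> sl1 sy; set S := susc _.
  have nS : n%:R <= S%:R :> R by rewrite ler_nat susc_ge.
  have S0 : 0 < S%:R :> R by apply: lt_le_trans nS.
  have nS1 : n%:R / S%:R <= 1 :> R by rewrite ler_pdivrMr // mul1r.
  have Z0 : 0 <= (z * n%:R)^-1 * Z l1.
    by rewrite mulr_ge0 // ?invr_ge0 ?(ltW zn0) // mulr_ge0.
  have dev0 b : 0 <= (nat_of_bool b)%:R :> R by [].
  case V1: (dev k.+1 _ _ _ _ _); first by have := dev0 (dev k r (i + j) tau e (y ++ l1)); rewrite /=; lra.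
  case V2: (dev k _ _ _ _ _); first by rewrite /=; lra.
  have [|gS] := leP (n%:R / S%:R) (g / 2); first by rewrite /=; lra.
  suff : 1 <= (z * n%:R)^-1 * Z l1 by rewrite /=; lra.
  have DK : (D1 k l1 <= K)%N \/ st l1 k = [::].
    case: sub => [i0|rk]; [right|left].
      by move: sl1; rewrite i0 => /size0nil ->.
    have := devPn (negbT V2) (leq_addr j i); rewrite addKn => /(_ sy).
    rewrite rk subr0 ger0_norm ?divr_ge0 // ler_pdivrMr // => h.
    by rewrite /K truncn_ge_nat // mulr_ge0 // ltW.
  have Dx : x * 3 / 4 * n%:R <= (D1 k.+1 (y ++ l1))%:R.
    have := devPn (l' := [::]) (l := y ++ l1) (negbT V1) (leqnn _); rewrite subnn => /(_ erefl).
    rewrite -/x ler_norml => /andP[h _].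
    rewrite -ler_pdivlMr //; lra.
  have := D1_window k y l1 K0 n0.
  rewrite -(ler_nat R) natrM natrD !natrM -/q -/S.
  have K0q : K0%:R = q - 1 by rewrite /q -natr1 addrK.
  rewrite K0q -natr1 natrM => win.
  set s := (size (st l1 k))%:R in win.
  have s0 : 0 <= s by [].
  have S2 : S%:R < 2 * n%:R / g.
    by move: gS; rewrite ltr_pdivlMr // [_ < _ / _]ltr_pdivlMr //; lra.
  have S3 : S%:R < n%:R * x * q / 4.
    apply: lt_le_trans S2 _; rewrite ler_pdivrMr //.
    have : 8 * n%:R <= q * (g * x) * n%:R by rewrite ler_pM2r.
    lra.
  have zs : z * n%:R <= s.
    rewrite leNgt; apply/negP => sz.
    have s8 : s * (8 * q) < x * n%:R.
      move: sz; rewrite /z mulrAC ltr_pdivlMr ?mulr_gt0 //.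
    have h1 : s * (8 * q) * q < x * n%:R * q by rewrite ltr_pM2r.
    have h2 : 4 * q * q <= n%:R * x * q by rewrite ler_pM2r.
    have h3 : x * 3 / 4 * n%:R * q <= (D1 k.+1 (y ++ l1))%:R * q by rewrite ler_pM2r.
    have h4 : 0 <= s * q by rewrite mulr_ge0 // ltW.
    have h5 : (2 * s + 1) * (q - 1) * q <= 2 * s * q * q + q * q by nra.
    lra.
  rewrite mulrC ler_pdivlMr // mul1r /Z.
  case: DK => [->|st0]; first by rewrite mulr1.
  by move: zs; rewrite /s st0 /= leNgt zn0.
pose W : option (pr n) -> R := wt (pp n tau r).
have rR : 0 < r%:R :> R by rewrite ltr0n.
have p0 : 0 <= pp n tau r by apply: pp_ge0.
have pN : #|{: pr n}|%:R * pp n tau r <= 1 by apply: pp_card.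
have pn : pp n tau r * n%:R <= tau / r%:R by apply: pp_le.
have lower : g <= Ex W (i * r) (fun=> Ex W (j * r) (fun y => n%:R / (susc (st y 0))%:R)).
  rewrite (Ex_cst (sum_wt n (pp n tau r))).
  apply: le_trans (Ex_susc p0 pN (j * r) n0).
  rewrite /g lerD2l lerN2 [n%:R * _]mulrC.
  apply: le_trans (ler_wpM2r _ pn) _; first by rewrite ler0n.
  by rewrite le_eqVlt natrM; apply/orP; left; apply/eqP; field; rewrite gt_eqF.
have upper : Ex W (i * r) (fun l1 => Ex W (j * r) (fun y => g / 2 +
    ((dev k.+1 r (i + j) tau (x / 4) (y ++ l1))%:R + (dev k r (i + j) tau e (y ++ l1))%:R)
    + (z * n%:R)^-1 * Z l1)) <= g / 2 + (2 * (g / 32) + 2 * (g / 32)) + (z * n%:R)^-1 * Ex W (i * r) Z.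
  move: H1 H2; rewrite -/W mulnDl [(i * r + j * r)%N]addnC !Ex_cat => H1 H2.
  rewrite -ExZ; apply: le_trans (lerD (lerD (lexx (g / 2)) (lerD H1 H2)) (lexx _)).
  rewrite -(Ex_cst (sum_wt n (pp n tau r)) (i * r) (g / 2)) -/W -!ExD le_eqVlt.
  apply/orP; left; apply/eqP/eq_Ex => l1 _.
  by rewrite !ExD !(Ex_cst (sum_wt n (pp n tau r))).
have mid : Ex W (i * r) (fun=> Ex W (j * r) (fun y => n%:R / (susc (st y 0))%:R)) <=
  Ex W (i * r) (fun l1 => Ex W (j * r) (fun y => g / 2 +
    ((dev k.+1 r (i + j) tau (x / 4) (y ++ l1))%:R + (dev k r (i + j) tau e (y ++ l1))%:R)
    + (z * n%:R)^-1 * Z l1)).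
  apply: le_EX => // l1 s1; apply: le_EX => // y sy; exact: key.
have EZ : (z * n%:R)^-1 * Ex W (i * r) Z <= g / 8.
  rewrite mulrC ler_pdivrMr //.
  apply: le_trans (Ex_size_st p0 pN k (i * r) K) _.
  have Kn : K%:R <= e * n%:R by rewrite truncn_le mulr_ge0 // ltW.
  rewrite !natrM.
  apply: (@le_trans _ _ ((tau / r%:R) * (i%:R * r%:R) * (e * n%:R))).
    have -> : pp n tau r * (i%:R * r%:R * n%:R * K%:R) =
       (pp n tau r * n%:R) * (i%:R * r%:R) * K%:R by ring.
    apply: ler_pM => //; first by apply: mulr_ge0; apply: mulr_ge0.
    by apply: ler_wpM2r => //; rewrite mulr_ge0.
  have -> : tau / r%:R * (i%:R * r%:R) * (e * n%:R) = (i%:R * tau) / a * (g / 8 * (z * n%:R)).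
    by rewrite /e; field; rewrite !gt_eqF.
  apply: ler_piMl.
    by apply: mulr_ge0; [apply: divr_ge0; rewrite ?ltW | exact: ltW].
  by rewrite ler_pdivrMr // mul1r lerDr.
(* The upper bound is at most g/2 + g/8 + g/8 = 3g/4, less than g. *)
have := le_trans lower (le_trans mid upper); lra.
Qed.

(** The blocks [l1], [l2], [l3] end at j tau, (j+1) tau and (j+2) tau. If the inequality failed, at
    most 2 e n vertices could be pendant outside rare words, against an average of at least c n. *)
Lemma strict_grid k j (tau b : R) : 0 < tau -> 0 < b -> b <= rho k.+1 (j%:R * tau) ->
  rho k.+1 (j.+2%:R * tau) <= rho k.+1 (j.+1%:R * tau) + b / 2 ->
  rho k.+1 (j.+1%:R * tau) < rho k (j.+1%:R * tau).
Proof.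
move=> tau0 b0 bs Tb; rewrite ltNge; apply/negP => kk.
(* [c0] bounds the chance that a vertex is untouched in [l1], and [c1] that of exactly k edges in
   [l2], all to a giant of at least be n vertices. The half in [c] pays for words with a smaller
   giant. *)
pose be := b / 2; have be0 : 0 < be by rewrite divr_gt0.
pose c0 := expR (- (2 * (j%:R * tau))) : R.
pose c1 := (tau * be / 4) ^+ k / k`!%:R * expR (- (2 * tau)).
have c00 : 0 < c0 by apply: expR_gt0.
have c10 : 0 < c1.
  rewrite mulr_gt0 ?expR_gt0 // divr_gt0 ?ltr0n ?fact_gt0 // exprn_gt0 //.
  by rewrite divr_gt0 // mulr_gt0.
pose c := c0 * c1 / 2; have c_gt0 : 0 < c by rewrite divr_gt0 // mulr_gt0.
have [e [e0 ec eb]] : exists e, [/\ 0 < e, e <= c / 8 & e <= b / 8].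
  by apply: min_pos; rewrite divr_gt0.
have [de [de0 dec0 dec]] : exists e, [/\ 0 < e, e <= c0 / 4 & e <= c / 32].
  by apply: min_pos; rewrite divr_gt0.
(* [N1] gives the giant at least two vertices; [N2] makes a failure to merge have probability at
   most c/8. *)
pose N1 := Num.truncn be^-1; pose A := 2 ^+ k.+1 * 32 / (c * be ^+ 2 * tau) : R.
pose N2 := Num.truncn A.
have [n [Nn n0 pick_r]] := common_nr k.+1 k j.+2 (N1 + N2).+1 tau0 e0 e0 de0 de0.
have nR : 0 < n%:R :> R by rewrite ltr0n.
have bn : 1 < be * n%:R.
  rewrite -ltr_pdivrMl // mulr1; apply: lt_le_trans (truncnS_gt _) _.
  by rewrite ler_nat; apply: leq_trans Nn; rewrite ltnS leq_addr.
have An : A <= n%:R.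
  apply: ltW; apply: lt_le_trans (truncnS_gt _) _.
  by rewrite ler_nat; apply: leq_trans Nn; rewrite ltnS leq_addl.
pose M := Num.truncn (2 * tau + n%:R * tau).
have [r [rM r0 H1 H2]] := pick_r (2 * k + M.+1)%N.
have rR : 0 < r%:R :> R by rewrite ltr0n.
have Mr : 2 * tau + n%:R * tau <= r%:R.
  apply: ltW; apply: lt_le_trans (truncnS_gt _) _.
  by rewrite ler_nat; apply: leq_trans rM; rewrite leq_addl.
have nt0 : 0 <= n%:R * tau by rewrite mulr_ge0 // ltW.
have nr : n%:R * tau <= r%:R by lra.
have h2 : tau / r%:R <= 2^-1 by rewrite ler_pdivrMr //; lra.
have k2 : (2 * k <= r)%N by apply: leq_trans rM; rewrite leq_addr.
have p0 : 0 <= pp n tau r by apply: pp_ge0.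
have pN : #|{: pr n}|%:R * pp n tau r <= 1 by apply: pp_card.
have pn : pp n tau r * n%:R <= tau / r%:R by apply: pp_le.
have pn1 : pp n tau r * n%:R <= 1 by lra.
pose W : option (pr n) -> R := wt (pp n tau r).
have W1 : \sum_a W a = 1 := sum_wt n (pp n tau r).
have sumr : (j.+2 * r = r + (r + j * r))%N by rewrite !mulSn.
have dens (m : nat) (l : seq (option (pr n))) i x : x = rho m (i%:R * tau) ->
    `|(D1 m l)%:R / n%:R - rho m (i%:R * tau)| <= e ->
    (x - e) * n%:R <= (D1 m l)%:R <= (x + e) * n%:R.
  move=> ->; rewrite ler_norml => /andP[h1 h3].
  by apply/andP; split; [rewrite -ler_pdivlMr //|rewrite -ler_pdivrMr //]; lra.
have del : Ex W (j * r) (fun l => ((D1 k.+1 l)%:R < be * n%:R)%R%:R) <= 2 * de.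
  apply: le_trans H1; rewrite sumr addnA.
  rewrite -(Ex_drop W1 (r + r) (j * r)); apply: le_EX => // l sl.
  case V: (dev k.+1 _ _ _ _ _); first by rewrite ler_nat leq_b1.
  have sd : size (take (r + r) l) = ((j.+2 - j) * r)%N.
    by rewrite size_takel ?sl ?leq_addr // -addn2 addKn mul2n addnn.
  rewrite -[l in dev _ _ _ _ _ l](cat_take_drop (r + r)) in V.
  have := dens _ _ j _ erefl (devPn (negbT V) (leqW (leqnSn j)) sd).
  case/andP => h1 _; rewrite ltNge (le_trans _ h1) // ler_pM2r //.
  rewrite /be; lra.
have binom_part : (tau * be / 4) ^+ k / k`!%:R <= 'C(r, k)%:R * (pp n tau r * (be * n%:R)) ^+ k.
    have bn0 : 0 <= be * n%:R by apply: mulr_ge0 => //; exact: ltW.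
    have pb0 : 0 <= pp n tau r * (be * n%:R) by apply: mulr_ge0.
    apply: le_trans (ler_wpM2r _ (bin_ge R k2)); last exact: exprn_ge0.
    rewrite [leRHS]mulrAC ler_wpM2r ?invr_ge0 // -exprMn; apply: lerXn2r; rewrite ?nnegrE.
    + by apply: divr_ge0 => //; apply: mulr_ge0; exact: ltW.
    + by apply: mulr_ge0 => //; exact: divr_ge0.
    have h3 := pp_ge n0 r0 tau0 nr.
    have -> : r%:R / 2 * (pp n tau r * (be * n%:R)) = r%:R * be / 2 * (pp n tau r * n%:R) by ring.
    apply: le_trans (ler_wpM2l _ h3); last by apply: divr_ge0 => //; apply: mulr_ge0 => //; exact: ltW.
    rewrite le_eqVlt; apply/orP; left; apply/eqP; field; rewrite gt_eqF //.
pose Y (l1 l2 : seq (option (pr n))) : {set 'I_n} := [set v | pendant (giant k.+1 l1) k l1 l2 v]%SET.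
have low : n%:R * c <= Ex W (j * r) (fun l1 => Ex W r (fun l2 =>
     (be * n%:R <= (D1 k.+1 l1)%:R)%R%:R * #|Y l1 l2|%:R)).
  apply: le_trans (Ex_pendant p0 pN pn1 n0 bn (ltW c10) (c0 := c0) _ _ del).
  - rewrite ler_pM2l // /c mulrAC ler_pM2r //; lra.
  - apply: le_trans (pow_ge_exp n0 r0 tau0 (j * r) h2); rewrite ler_expR lerN2 natrM.
    rewrite le_eqVlt; apply/orP; left; apply/eqP; field; rewrite gt_eqF //.
  - rewrite /c1; apply: ler_pM; [|exact: expR_ge0| |].
    + by apply: divr_ge0 => //; apply: exprn_ge0; apply: divr_ge0 => //; apply: mulr_ge0; exact: ltW.
    + exact: binom_part.
    apply: le_trans (pow_ge_exp n0 r0 tau0 r h2); rewrite ler_expR lerN2.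
    rewrite le_eqVlt; apply/orP; left; apply/eqP; field; rewrite gt_eqF //.
(* Given [l1] and [l2] the two sets are fixed, and the newer giant is at least as large as the older
   one, so [Ex_merge_fail] applies to [l3]. *)
pose mf (l1 l2 l3 : seq (option (pr n))) : bool :=
  [&& (be * n%:R <= (D1 k.+1 l1)%:R)%R,
    [disjoint giant k.+1 (l2 ++ l1) & giant k.+1 l1] &
    (count (joins (giant k.+1 (l2 ++ l1)) (giant k.+1 l1)) l3 < k.+1)%N].
have mfP l1 l2 : Ex W r (fun l3 => (mf l1 l2 l3)%:R) <= c / 8.
  have c80 : 0 <= c / 8 by rewrite ltW // divr_gt0.
  case C: ((be * n%:R <= (D1 k.+1 l1)%:R)%R &&
    [disjoint giant k.+1 (l2 ++ l1) & giant k.+1 l1]); last first.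
    rewrite -(Ex_cst W1 r (c / 8)); apply: le_EX => // l3 _.
    by rewrite /mf andbA C.
  rewrite (@eq_Ex _ _ _ _ _ (fun l3 => (count (joins (giant k.+1 (l2 ++ l1)) (giant k.+1 l1)) l3
     < k.+1)%N%:R)); last by move=> l3 _; rewrite /mf andbA C.
  case/andP: C => big dj.
  apply: le_trans (Ex_merge_fail k.+1 n0 r0 tau0 nr dj) _.
  apply: (merge_fail_small nR tau0 be0 c_gt0 An).
  have [b1 [-> Eb1]] := giantP k.+1 l1 n0; have [b2 [-> Eb2]] := giantP k.+1 (l2 ++ l1) n0.
  have bn0 : 0 <= be * n%:R by apply: mulr_ge0 => //; exact: ltW.
  rewrite natrM Eb1 Eb2 expr2 mulrACA; apply: ler_pM => //.
  apply: le_trans big _; rewrite ler_nat; elim: (l2) => //= a l' IH; apply: leq_trans IH (D1_cons _ _ _).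
have key (l1 l2 l3 : seq (option (pr n))) : size l1 = (j * r)%N -> size l2 = r -> size l3 = r ->
  (be * n%:R <= (D1 k.+1 l1)%:R)%R%:R * #|Y l1 l2|%:R <= n%:R * (2 * e +
    ((dev k.+1 r j.+2 tau e (l3 ++ l2 ++ l1))%:R + (dev k r j.+2 tau e (l3 ++ l2 ++ l1))%:R)
    + (mf l1 l2 l3)%:R).
  move=> s1 s2 s3.
  have bool01 (x : bool) : 0 <= x%:R :> R by [].
  have e20 : 0 <= 2 * e by rewrite mulr_ge0 // ltW.
  have Yn : #|Y l1 l2|%:R <= n%:R :> R by rewrite ler_nat -[X in (_ <= X)%N]card_ord max_card.
  have triv (x : R) : 1 <= x ->
      (be * n%:R <= (D1 k.+1 l1)%:R)%R%:R * #|Y l1 l2|%:R <= n%:R * x.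
    move=> x1; apply: (@le_trans _ _ n%:R); last by rewrite ler_peMr.
    by case: (be * n%:R <= _)%R; rewrite ?mulr1n ?mulr0n ?mul1r ?mul0r.
  case V1: (dev k.+1 _ _ _ _ _).
    by apply: triv; rewrite mulr1n -addrA addrCA -addrA lerDl !addr_ge0.
  case V2: (dev k _ _ _ _ _).
    by apply: triv; rewrite mulr1n mulr0n add0r addrAC lerDr addr_ge0.
  case V3: (mf _ _ _).
    by apply: triv; rewrite mulr1n mulr0n lerDr !addr_ge0.
  rewrite !mulr0n !addr0.
  case big: (be * n%:R <= _)%R; last by rewrite mulr0n mul0r mulr_ge0.
  rewrite mulr1n mul1r.
  have i2 : ((j.+2 - j) * r)%N = (r + r)%N by rewrite -addn2 addKn mul2n addnn.
  have i1 : ((j.+2 - j.+1) * r)%N = r by rewrite subSS subSnn mul1n.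
  have s32 : size (l3 ++ l2) = ((j.+2 - j) * r)%N by rewrite size_cat s3 s2 i2.
  have s31 : size l3 = ((j.+2 - j.+1) * r)%N by rewrite s3 i1.
  have s30 : size (@nil (option (pr n))) = ((j.+2 - j.+2) * r)%N by rewrite subnn.
  have V1' := V1; rewrite catA in V1'.
  have /andP[a1 _] := dens _ _ j _ erefl (devPn (negbT V1') (leqW (leqnSn j)) s32).
  have /andP[a2 _] := dens _ _ j.+1 _ erefl (devPn (negbT V1) (leqnSn _) s31).
  have /andP[_ a3] := dens _ _ j.+2 _ erefl (devPn (l' := [::]) (negbT V1) (leqnn _) s30).
  have /andP[_ a4] := dens _ _ j.+1 _ erefl (devPn (negbT V2) (leqnSn _) s31).
  have D2 : (1 < #|giant k.+1 (l2 ++ l1)|)%N.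
    have [b2 [-> ->]] := giantP k.+1 (l2 ++ l1) n0.
    rewrite -(ltr_nat R); apply: lt_le_trans bn _; apply: le_trans big _.
    rewrite ler_nat; elim: (l2) => //= a l' IH; apply: leq_trans IH (D1_cons _ _ _).
  case: (strict_gap l3 n0 D2).
  - rewrite -(ler_nat R) natrD => h.
    exact: gap_arith kk a2 a4 h (ltW nR).
  - rewrite -(ler_nat R) natrD => h; exfalso.
    exact: merge_arith nR b0 eb bs Tb a1 a2 a3 h.
  - by case=> dj few; move: V3; rewrite /mf big dj few.
have up : Ex W (j * r) (fun l1 => Ex W r (fun l2 => Ex W r (fun l3 => n%:R * (2 * e +
    ((dev k.+1 r j.+2 tau e (l3 ++ l2 ++ l1))%:R + (dev k r j.+2 tau e (l3 ++ l2 ++ l1))%:R)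
    + (mf l1 l2 l3)%:R)))) <= n%:R * (2 * e + (2 * de + 2 * de) + c / 8).
  move: H1 H2; rewrite -/W sumr !Ex_cat => H1 H2.
  apply: (@le_trans _ _ (Ex W (j * r) (fun l1 => Ex W r (fun l2 => n%:R * (2 * e +
    (Ex W r (fun l3 => (dev k.+1 r j.+2 tau e (l3 ++ l2 ++ l1))%:R) +
     Ex W r (fun l3 => (dev k r j.+2 tau e (l3 ++ l2 ++ l1))%:R)) + c / 8))))).
    apply: le_EX => // l1 _; apply: le_EX => // l2 _.
    by rewrite ExZ !ExD (Ex_cst W1) ler_wpM2l // lerD2l.
  rewrite (@eq_Ex _ _ _ _ _ (fun l1 => n%:R * (2 * e +
    (Ex W r (fun l2 => Ex W r (fun l3 => (dev k.+1 r j.+2 tau e (l3 ++ l2 ++ l1))%:R)) +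
     Ex W r (fun l2 => Ex W r (fun l3 => (dev k r j.+2 tau e (l3 ++ l2 ++ l1))%:R))) + c / 8))).
    by rewrite ExZ !ExD !(Ex_cst W1) ler_wpM2l // lerD2r lerD2l lerD.
  by move=> l1 _; rewrite ExZ !ExD !(Ex_cst W1).
have mid : Ex W (j * r) (fun l1 => Ex W r (fun l2 =>
     (be * n%:R <= (D1 k.+1 l1)%:R)%R%:R * #|Y l1 l2|%:R)) <=
  Ex W (j * r) (fun l1 => Ex W r (fun l2 => Ex W r (fun l3 => n%:R * (2 * e +
    ((dev k.+1 r j.+2 tau e (l3 ++ l2 ++ l1))%:R + (dev k r j.+2 tau e (l3 ++ l2 ++ l1))%:R)
    + (mf l1 l2 l3)%:R)))).
  apply: le_EX => // l1 s1; apply: le_EX => // l2 s2.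
  rewrite -[leLHS](Ex_cst W1 r); apply: le_EX => // l3 s3; exact: key.
have := le_trans low (le_trans mid up); rewrite ler_pM2l //.
by apply: final_arith; [exact: c_gt0 | exact: ec | exact: dec].
Qed.

End Limits.

(** * One-sided continuity, and grids adapted to a given time *)

Section RightModulus.
Local Open Scope classical_set_scope.

Lemma right_modulus (R : realType) (f : R -> R) (t e : R) :
  {within [set t : R | 0 <= t], continuous f} -> 0 <= t -> 0 < e ->
  exists2 eta, 0 < eta & forall u, t <= u -> u < t + eta -> f u <= f t + e.
Proof.
move=> /subspace_continuousP/(_ t) /= H t0 e0.
move: (H t0) => /cvgrPdist_lt/(_ e e0); rewrite near_withinE => /nbhs_ballP[eta /= eta0 Hb].
exists eta => // u tu ut.
have : `|f t - f u| < e.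
  apply: Hb; last exact: le_trans tu.
  by rewrite /ball /= ler0_norm ?subr_le0 //; lra.
by rewrite ltr_norml => /andP[h _]; lra.
Qed.

End RightModulus.

Local Open Scope classical_set_scope.
Local Open Scope ring_scope.

Theorem theorem2p3 (R : realType)
  (d : nat -> measure_display) (Omega : forall n, measurableType (d n))
  (P : forall n, probability (Omega n) R)
  (E : forall n, Omega n -> 'I_n -> 'I_n -> set R)
  (rho : nat -> R -> R) (sigma : nat -> R) :
  (* model: for each n >= 1, independent Poisson processes of rate 1/n *)
  (forall n, (0 < n)%N -> poisson_family (P n) (n%:R)^-1 (E n)) ->
  (* conventions *)
  (forall t, 0 <= t -> rho 0%N t = 1) -> sigma 0%N = 0 ->
  (* rho_k, k >= 1: continuous, increasing, [0,1]-valued on [0,oo) *)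
  (forall k, (1 <= k)%N ->
     {within [set t : R | 0 <= t], continuous (rho k)} /\
     {in [pred t : R | 0 <= t] &, {homo rho k : s t / s <= t}} /\
     (forall t, 0 <= t -> 0 <= rho k t <= 1)) ->
  (* C_1(G_k(t))/n -> rho_k(t) in probability, uniformly in t >= 0 *)
  (forall k, (1 <= k)%N -> forall eps delta : R, 0 < eps -> 0 < delta ->
     \forall n \near \oo,
       outer_le (P n)
         [set w | exists t, 0 <= t /\
            eps < `| (C1 (upto (Gk (E n w) k.-1) t))%:R / n%:R - rho k t |]
         delta) ->
  (* sigma_k > 0 is the threshold of rho_k *)
  (forall k, (1 <= k)%N ->
     0 < sigma k /\
     (forall t, 0 <= t -> t <= sigma k -> rho k t = 0) /\
     (forall t, sigma k < t -> 0 < rho k t)) ->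
  forall k, (1 <= k)%N ->
    (forall t, 0 <= t ->
       rho k t <= rho k.-1 t /\ (0 < rho k.-1 t -> rho k t < rho k.-1 t)) /\
    sigma k.-1 + 1 <= sigma k.
Proof.
move=> poi rho0 sig0 reg conv thr [//|k] _; rewrite /=.
have [_ [mono _]] := reg k.+1 isT; have [sk [below above]] := thr k.+1 isT.
split=> [t|].
  rewrite le_eqVlt => /predU1P[<-|t0].
    have -> : rho k.+1 0 = 0 by apply: below; rewrite // ltW.
    split=> //; case: (posnP k) => [->|k0]; first by rewrite rho0.
    by have [s0 [-> //]] := thr k k0; rewrite ltW.
  split=> [|rk]; first exact: (rho_mono poi rho0 conv).
  have [ts|ts] := leP t (sigma k.+1); first by rewrite below // ltW.
  pose s := (sigma k.+1 + t) / 2.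
  have s1 : sigma k.+1 < s by rewrite /s; lra.
  have st : s < t by rewrite /s; lra.
  have b0 : 0 < rho k.+1 s := above s s1.
  have b20 : 0 < rho k.+1 s / 2 by rewrite divr_gt0.
  have [eta eta0 cont] := right_modulus (reg k.+1 isT).1 (ltW t0) b20.
  have ts0 : 0 < t - s by rewrite subr_gt0.
  have [m [m0 ms meta]] := min_pos ts0 eta0.
  (* The step is smaller than both t - s and [eta]: t - tau is still later than s, where a giant
     exists, and t + tau stays within reach of [cont]. *)
  pose j := Num.truncn (t / m); pose tau := t / j.+1%:R.
  have j0 : 0 < j.+1%:R :> R by rewrite ltr0n.
  have tau0 : 0 < tau by rewrite divr_gt0.
  have taum : tau < m.
    by rewrite /tau ltr_pdivrMr // mulrC -ltr_pdivrMr // truncnS_gt.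
  have tE : j.+1%:R * tau = t by rewrite /tau mulrC divfK ?gt_eqF.
  have jE : j%:R * tau = t - tau by rewrite -tE -natr1; ring.
  have j2E : j.+2%:R * tau = t + tau by rewrite -[j.+2%:R]natr1 mulrDl tE mul1r.
  have := strict_grid poi rho0 conv (k := k) (j := j) tau0 b0; rewrite tE jE j2E; apply.
    by apply: mono; rewrite ?inE; lra.
  by apply: cont; lra.
rewrite leNgt; apply/negP => lt.
have sk0 : 0 <= sigma k by case: (posnP k) => [->|k0]; [rewrite sig0 | rewrite ltW //; case: (thr k k0)].
(* A time past both thresholds but less than 1 after sigma_k; positivity of rho_(k+1) there is what
   [no_giant] contradicts. *)
pose t := (Num.max (sigma k.+1) (sigma k) + (sigma k + 1)) / 2.
have [m1 m2] : sigma k.+1 <= Num.max (sigma k.+1) (sigma k) /\ sigma k <= Num.max (sigma k.+1) (sigma k).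
  by rewrite !le_max !lexx orbT.
have m3 : Num.max (sigma k.+1) (sigma k) < sigma k + 1 by rewrite gt_max lt ltrDl ltr01.
have t1 : sigma k.+1 < t by rewrite /t; lra.
have t2 : sigma k < t by rewrite /t; lra.
have t3 : t < sigma k + 1 by rewrite /t; lra.
move: t t1 t2 t3 => t t1 t2 t3.
have t0 : 0 < t by apply: le_lt_trans t2.
have g0 : 0 < 1 - (t - sigma k) by lra.
(* With tau < 1 - (t - sigma_k), rounding sigma_k down to a grid time still leaves a window shorter
   than 1. *)
pose J := (Num.truncn (t / (1 - (t - sigma k)))).+1; pose tau := t / J%:R.
have J0 : 0 < J%:R :> R by rewrite ltr0n.
have tau0 : 0 < tau by rewrite divr_gt0.
have taug : tau < 1 - (t - sigma k).
  by rewrite /tau ltr_pdivrMr // mulrC -ltr_pdivrMr // truncnS_gt.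
have tE : J%:R * tau = t by rewrite /tau mulrC divfK ?gt_eqF.
pose i := Num.truncn (sigma k / tau).
have sd0 : 0 <= sigma k / tau by rewrite divr_ge0 // ltW.
have /andP[i1 i2] := truncn_itv sd0; rewrite -/i in i1 i2.
have {}i1 : i%:R * tau <= sigma k by rewrite -ler_pdivlMr.
have {}i2 : sigma k < i%:R * tau + tau.
  by move: i2; rewrite ltr_pdivrMr // -natr1 mulrDl mul1r.
have iJ : (i <= J)%N.
  by rewrite -(ler_nat R) -(ler_pM2r tau0) tE ltW // (le_lt_trans i1).
have jt : (J - i)%:R * tau < 1 by rewrite natrB // mulrBl tE; lra.
(* For k = 0 the window starts at time 0, because sigma_0 = 0 forces i = 0. *)
have sub : i = 0%N \/ rho k (i%:R * tau) = 0.
  have it0 : 0 <= i%:R * tau by rewrite mulr_ge0 // ltW.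
  case: (posnP k) => [k0|k0]; [left|right]; last by have [_ [-> //]] := thr k k0.
  apply/eqP; rewrite -leqn0 leqNgt; apply/negP => ip.
  have : 0 < i%:R * tau by rewrite mulr_gt0 // ltr0n.
  by rewrite ltNge; move: i1; rewrite k0 sig0 => ->.
have := no_giant poi rho0 conv tau0 jt sub; rewrite subnKC // tE leNgt.
by rewrite above.
Qed.
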